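(* For a nonzero abelian ideal $I$ of $\mathfrak b$, one has $I=I(\mu)_{\min}$ for $\mu=\mathrm{rt}(I)$ if and only if $\mathrm{rt}(I)^\vee=z_I$.
   Context: Let $\mathfrak g$ be a complex simple Lie algebra with triangular decomposition $\mathfrak g=\mathfrak u\oplus\mathfrak t\oplus\mathfrak u^-$, Borel subalgebra $\mathfrak b=\mathfrak u\oplus\mathfrak t$, root system $\Delta$ of $(\mathfrak g,\mathfrak t)$, positive roots $\Delta^+$ (corresponding to $\mathfrak u$), simple roots $\Pi=\{\alpha_1,\dots,\alpha_n\}$, highest root $\theta$, Weyl group $W$, and $W$-invariant inner product $(\ ,\ )$ on $V=\bigoplus_i\mathbb R\alpha_i$. $\Delta^+_l$ is the set of long positive roots (all roots are long in the simply-laced case). Root order on $\Delta^+$: $\mu\preccurlyeq\nu$ iff $\nu-\mu$ is a non-negative integral combination of simple roots. Abelian ideals: $\mathfrak{Ab}$ is the poset (under inclusion) of subspaces $\mathfrak a\subset\mathfrak u$ with $[\mathfrak b,\mathfrak a]\subset\mathfrak a$ and $[\mathfrak a,\mathfrak a]=0$. Each is a sum of root spaces and is identified with the corresponding set $I\subset\Delta^+$, which is an upper ideal of $(\Delta^+,\preccurlyeq)$ with no two elements summing to a root. Minuscule elements: let $\widehat V=V\oplus\mathbb R\delta\oplus\mathbb R\lambda$ with $(\delta,V)=(\lambda,V)=(\delta,\delta)=(\lambda,\lambda)=0$, $(\delta,\lambda)=1$; $\alpha_0=\delta-\theta$; $\mu^\vee=2\mu/(\mu,\mu)$; $s_i(x)=x-(x,\alpha_i)\alpha_i^\vee$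 for $0\le i\le n$; $\widehat W=\langle s_0,\dots,s_n\rangle\subset GL(\widehat V)$; $\widehat\Delta^+=\Delta^+\cup\{\gamma+k\delta\mid\gamma\in\Delta,\ k\ge1\}$; $\mathcal N(w)=\{\nu\in\widehat\Delta^+\mid w(\nu)\in-\widehat\Delta^+\}$. An element $w\in\widehat W$ is minuscule if $\mathcal N(w)=\{\delta-\gamma\mid\gamma\in I_w\}$ for some $I_w\subset\Delta$. Then $I_w$ is an abelian ideal and $w\mapsto I_w$ is a bijection from minuscule elements onto $\mathfrak{Ab}$; write $w_I$ for the element corresponding to $I$. Rootlets: for a nonzero abelian ideal $I$, the rootlet is $\mathrm{rt}(I)=w_I(2\delta-\theta)$, which lies in $\Delta^+_l$. For $\mu\in\Delta^+_l$, $\mathfrak{Ab}_\mu$ is the set of nonzero abelian ideals with rootlet $\mu$. It is known that $\mathfrak{Ab}_\mu$ is nonempty and has a unique minimal element $I(\mu)_{\min}$ and a unique maximal element $I(\mu)_{\max}$. The element $z_I$ (Kostant–Peterson): let $Q^\vee=\bigoplus_{i=1}^n\mathbb Z\alpha_i^\vee$. Every $w\in\widehat W$ decomposes uniquely as $w=v\cdot t_r$ with $v\in W$, $r\in Q^\vee$, where the translation $t_r$ acts on $V\oplus\mathbb R\delta$ by $t_r(x)=x-(x,r)\delta$. For $w_I=v\cdot t_r$, put $z_I=v(r)\in Q^\vee$. Equivalently, writing $w_I^{-1}(\alpha_i)=\mu_i+k_i\delta$ with $\mu_i\in\Delta$, $k_i\in\mathbb Z$ for $i=1,\dots,n$, the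 element $z_I\in V$ is determined by $(z_I,\alpha_i)=k_i$ for all $i$. The map $I\mapsto z_I$ is a bijection of $\mathfrak{Ab}$ onto $\{z\in Q^\vee\mid -1\le(z,\gamma)\le2\ \ \forall\gamma\in\Delta^+\}$. *)

(* Defs.v *)
From HB Require Import structures.
From mathcomp Require Import all_boot all_order all_algebra.
From mathcomp Require Import complex.
From mathcomp Require Import classical_sets reals.

Set Implicit Arguments.
Unset Strict Implicit.
Unset Printing Implicit Defensive.

Import Order.TTheory GRing.Theory Num.Theory.
Local Open Scope ring_scope.
Local Open Scope complex_scope.
Local Open Scope classical_set_scope.

Section LieAlgebra.
Variables (R : realType) (g : vectType R[i]) (br : g -> g -> g).

Definition lie_bracket : Prop :=
  [/\ forall x, linear (br x),
      forall y, linear (br^~ y),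
      forall x, br x x = 0
    & forall x y z, br x (br y z) + br y (br z x) + br z (br x y) = 0].

Definition simple_lie : Prop :=
  (exists x y, br x y != 0) /\
  forall U : {vspace g}, (forall x y, y \in U -> br x y \in U) ->
    U = 0%VS \/ U = fullv.

(* A maximal abelian subalgebra acting diagonalizably on g: for a simple Lie
   algebra over the complex numbers these are the Cartan subalgebras. *)
Definition cartan_subalgebra (t : {vspace g}) : Prop :=
  [/\ forall h k, h \in t -> k \in t -> br h k = 0,
      forall x, (forall h, h \in t -> br h x = 0) -> x \in t
    & exists2 X : seq g, basis_of fullv X &
        forall x, x \in X -> forall h, h \in t ->
          exists c : R[i], br h x = c *: x].

Variable t : {vspace g}.

Definition dual : vectType R[i] := 'Hom(subvs_of t, (R[i])^o).

Definition root_space (a : dual) : set g :=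
  [set x | forall h : subvs_of t, br (vsval h) x = a h *: x].

Definition lie_root (a : dual) : Prop :=
  a != 0 /\ exists2 x, x != 0 & root_space a x.

Definition lie_coroot (a : dual) (h : subvs_of t) : Prop :=
  a h = 2 /\
  exists x y, [/\ root_space a x, root_space (- a) y & vsval h = br x y].

Definition simple_roots n (Pi : n.-tuple dual) : Prop :=
  [/\ free Pi,
      forall i : 'I_n, lie_root Pi`_i
    & forall a, lie_root a -> exists m : 'I_n -> nat,
        a = \sum_i (m i)%:R *: Pi`_i \/ a = - \sum_i (m i)%:R *: Pi`_i].

Variables (n : nat) (Pi : n.-tuple dual).

(* The real space V spanned by the simple roots is identified with 'rV[R]_n,
   a vector being given by its coordinates in the basis Pi. *)
Definition weight_of (x : 'rV[R]_n) : dual := \sum_i (x 0 i)%:C *: Pi`_i.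

Definition Delta : set 'rV[R]_n := [set x | lie_root (weight_of x)].

Definition root_le (x y : 'rV[R]_n) : Prop :=
  exists m : 'I_n -> nat, forall i, y 0 i - x 0 i = (m i)%:R.

Definition Delta_pos : set 'rV[R]_n := [set x | Delta x /\ root_le 0 x].

Definition highest_root (theta : 'rV[R]_n) : Prop :=
  Delta_pos theta /\ forall x, Delta_pos x -> root_le x theta.

Definition inner_product (ip : 'rV[R]_n -> 'rV[R]_n -> R) : Prop :=
  [/\ forall x, scalar (ip x),
      forall x y, ip x y = ip y x
    & forall x, x != 0 -> 0 < ip x x].

(* The Weyl group of (g, t) is generated by the reflections
   c |-> c - c(h) a of t^*, where h is the coroot of the root a. *)
Definition weyl_invariant (ip : 'rV[R]_n -> 'rV[R]_n -> R) : Prop :=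
  forall a h, lie_root a -> lie_coroot a h ->
  forall x y x' y' : 'rV[R]_n,
    weight_of x' = weight_of x - weight_of x h *: a ->
    weight_of y' = weight_of y - weight_of y h *: a ->
    ip x' y' = ip x y.

(* The nilradical u = sum of the positive root spaces, and b = t + u. *)
Definition u_space : set g :=
  [set x | exists2 s : seq g,
     (forall y, y \in s -> exists2 c, Delta_pos c & root_space (weight_of c) y)
     & x = \sum_(y <- s) y].

Definition borel : set g :=
  [set x | exists h y, [/\ h \in t, u_space y & x = h + y]].

Definition abelian_ideal (a : {vspace g}) : Prop :=
  [/\ forall x, x \in a -> u_space x,
      forall x y, borel x -> y \in a -> br x y \in a
    & forall x y, x \in a -> y \in a -> br x y = 0].

Definition ideal_roots (a : {vspace g}) : set 'rV[R]_n :=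
  [set c | Delta_pos c /\ forall x, root_space (weight_of c) x -> x \in a].

Section Affine.
Variables (ip : 'rV[R]_n -> 'rV[R]_n -> R) (theta : 'rV[R]_n).

(* (v, (d, l)) stands for v + d delta + l lambda. *)
Definition Vhat : lmodType R := ('rV[R]_n * (R^o * R^o))%type.

Definition inV (v : 'rV[R]_n) : Vhat := (v, (0, 0)).
Definition delta : Vhat := (0, (1, 0)).

Definition form (x y : Vhat) : R :=
  ip x.1 y.1 + x.2.1 * y.2.2 + x.2.2 * y.2.1.

Definition coroot (x : Vhat) : Vhat := (2 / form x x) *: x.

(* The index None is the affine node 0. *)
Definition alpha (i : option 'I_n) : Vhat :=
  if i is Some j then inV (delta_mx 0 j) else delta - inV theta.

Definition refl (i : option 'I_n) (x : Vhat) : Vhat :=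
  x - form x (alpha i) *: coroot (alpha i).

(* The generators being involutions, the generated groups consist of the
   products of words in the generators. *)
Definition word (s : seq (option 'I_n)) : Vhat -> Vhat :=
  foldr (fun i w => refl i \o w) id s.

Definition affine_weyl : set (Vhat -> Vhat) :=
  [set w | exists s : seq (option 'I_n), w = word s].

Definition weyl : set (Vhat -> Vhat) :=
  [set w | exists s : seq 'I_n, w = word (map Some s)].

Definition affine_pos : set Vhat :=
  [set x | (exists2 c, Delta_pos c & x = inV c) \/
           (exists c (k : nat),
              [/\ Delta c, (0 < k)%N & x = inV c + k%:R *: delta])].

Definition inversions (w : Vhat -> Vhat) : set Vhat :=
  [set x | affine_pos x /\ affine_pos (- w x)].

(* w = w_I, for I the set of roots of the abelian ideal a *)
Definition minuscule_of (a : {vspace g}) (w : Vhat -> Vhat) : Prop :=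
  affine_weyl w /\
  inversions w = [set delta - inV c | c in ideal_roots a].

Definition rootlet (w : Vhat -> Vhat) : Vhat := w (delta *+ 2 - inV theta).

Definition Ab (mu : Vhat) : set {vspace g} :=
  [set a | [/\ abelian_ideal a, a != 0%VS
             & exists2 w, minuscule_of a w & rootlet w = mu]].

Definition Ab_minimal (mu : Vhat) (a : {vspace g}) : Prop :=
  Ab mu a /\ forall b, Ab mu b -> (b <= a)%VS -> b = a.

(* a = I(mu)_min, the unique minimal element of Ab mu *)
Definition is_Imin (mu : Vhat) (a : {vspace g}) : Prop :=
  Ab_minimal mu a /\ forall b, Ab_minimal mu b -> b = a.

Definition coroot_lattice : set Vhat :=
  [set r | exists m : 'I_n -> int,
     r = \sum_i (m i)%:~R *: coroot (alpha (Some i))].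

Definition translation (r x : Vhat) : Vhat := x - form x r *: delta.

(* w = v t_r; the formula for t_r holds on V + R delta, on which the affine
   Weyl group acts faithfully. *)
Definition translation_decomp (w v : Vhat -> Vhat) (r : Vhat) : Prop :=
  [/\ weyl v, coroot_lattice r
    & forall x : Vhat, x.2.2 = 0 -> w x = v (translation r x)].

(* z = z_I, where w = w_I *)
Definition kostant_peterson (w : Vhat -> Vhat) (z : Vhat) : Prop :=
  exists v r, translation_decomp w v r /\ z = v r.

End Affine.
End LieAlgebra.

(* Main.v *)
Require Import Defs.
From HB Require Import structures.
From mathcomp Require Import all_boot all_order all_algebra.
From mathcomp Require Import complex ring lra zify.
From mathcomp Require Import boolp classical_sets reals.

(** Write w = w_I, decompose it as w = v t_r with v in W and r in the coroot
    lattice, let mu be the rootlet, and let H be the set of positive roots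
    gamma with (gamma, theta) > 0.  The rootlet of I is minimal, respectively
    has coroot z_I, for one and the same reason: both conditions say that the
    set of roots of I is contained in H.

    Rootlet and translation.  Since theta is a root of I, w sends delta - theta
    to a negative root and 2 delta - theta to a positive one, so (theta, r) is
    -1 or -2.  The value -1 would force |(gamma, r)| <= 1 for all roots gamma,
    and the coroot lattice contains no nonzero vector with that property
    (colattice_minuscule).  Hence mu = - v(theta), and as z_I = v(r), the
    equality of z_I with the coroot of mu says that r = - theta^v
    (coroot_rootlet).

    Translation and H.  If r = - theta^v, comparing levels shows that only roots
    of H can belong to I (minuscule_level).  Conversely, if I lies in H, the
    inequalities satisfied by the levels of w give |(gamma, r + theta^v)| <= 1
    for all roots gamma, so r + theta^v = 0 by the same lattice argument
    (minuscule_translation).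

    Minimality and H.  If I is not contained in H, let gamma be a root of I
    outside H of smallest height.  Then - w(delta - gamma) cannot be a sum of
    two positive affine roots, so it is a simple affine root alpha_i
    (minuscule_lowest); it is orthogonal to mu.  Thus I without gamma is an
    abelian ideal with element s_i w and rootlet s_i(mu) = mu, and I is not
    minimal (minuscule_remove).  If on the other hand two ideals contained in H
    have the same rootlet, their finite parts v_1 and v_2 agree on theta, and
    v_2^-1 v_1 preserves the set of positive roots; an element of W doing so is
    the identity, so the ideals coincide (minuscule_unique).  Therefore the
    ideal of a given rootlet contained in H is the only minimal one.

    The properties of roots used here come from the Killing form.  A vector h
    of t on which all simple roots take the value 1 has Killing square a nonzero
    sum of squares of integers, so the form is not zero, and by simplicity it is
    nondegenerate.  Duality of opposite root spaces then provides sl2-triples.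
    The relation e f^(k+1) v = (k + 1) (l - k c / 2) f^k v on a vector v killed
    by e (raise_lower), where h acts on v by l and on f by - c, gives all the
    rest: integrality, reflections, one-dimensionality of root spaces and the
    nonvanishing of brackets between root spaces whose roots add to a root. *)

Set Implicit Arguments.
Unset Strict Implicit.
Unset Printing Implicit Defensive.
Import Order.TTheory GRing.Theory Num.Theory.
Local Open Scope ring_scope.

(** * Reflections *)

Section RootSystem.
Variables (R : realType) (n : nat) (ip : 'rV[R]_n -> 'rV[R]_n -> R).
Local Notation V := 'rV[R]_n.

(** The coroot 2 a / (a, a) as a vector of V.  It is locked so that rewriting
    with the linearity of ip does not see through it. *)
Fact dual_root_key : unit. Proof. exact: tt. Qed.
Definition dual_root : V -> V :=
  locked_with dual_root_key (fun a => (2 / ip a a) *: a).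
Lemma dual_root_unfold a : dual_root a = (2 / ip a a) *: a.
Proof. by rewrite /dual_root unlock. Qed.
Definition reflection (a x : V) : V := x - ip x (dual_root a) *: a.

Hypothesis ip_inner : inner_product ip.

Lemma ipC x y : ip x y = ip y x.
Proof. by case: ip_inner. Qed.

Lemma ip_gt0 x : x != 0 -> 0 < ip x x.
Proof. by case: ip_inner => _ _; apply. Qed.

Lemma ipDr x y z : ip x (y + z) = ip x y + ip x z.
Proof. by case: ip_inner => /(_ x 1 y z); rewrite scale1r mul1r. Qed.

Lemma ip0r x : ip x 0 = 0.
Proof. by apply/(addrI (ip x 0)); rewrite -ipDr !addr0. Qed.

Lemma ipZr k x y : ip x (k *: y) = k * ip x y.
Proof. by case: ip_inner => /(_ x k y 0); rewrite !addr0 ip0r addr0. Qed.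

Lemma ipNr x y : ip x (- y) = - ip x y.
Proof. by rewrite -scaleN1r ipZr mulN1r. Qed.

Lemma ipBr x y z : ip x (y - z) = ip x y - ip x z.
Proof. by rewrite ipDr ipNr. Qed.

Lemma ipDl x y z : ip (x + y) z = ip x z + ip y z.
Proof. by rewrite !(ipC _ z) ipDr. Qed.
Lemma ip0l x : ip 0 x = 0. Proof. by rewrite ipC ip0r. Qed.
Lemma ipZl k x y : ip (k *: x) y = k * ip x y.
Proof. by rewrite !(ipC _ y) ipZr. Qed.
Lemma ipNl x y : ip (- x) y = - ip x y.
Proof. by rewrite !(ipC _ y) ipNr. Qed.
Lemma ipBl x y z : ip (x - y) z = ip x z - ip y z.
Proof. by rewrite !(ipC _ z) ipBr. Qed.

Lemma ip_sumr I (s : seq I) (P : pred I) (F : I -> V) x :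
  ip x (\sum_(i <- s | P i) F i) = \sum_(i <- s | P i) ip x (F i).
Proof.
by elim/big_rec2: _ => [|i y1 y2 _ <-]; rewrite ?ip0r ?ipDr.
Qed.

Definition ipE := (ipDl, ipDr, ipBl, ipBr, ipNl, ipNr, ipZl, ipZr).

Lemma ip_dual_root x a : ip x (dual_root a) = 2 / ip a a * ip x a.
Proof. by rewrite dual_root_unfold ipZr. Qed.

Lemma ip_dual_root_id a : a != 0 -> ip a (dual_root a) = 2.
Proof.
by move=> a0; rewrite ip_dual_root divfK // gt_eqF // ip_gt0.
Qed.

Lemma ip_dual_root_gt0 x a : a != 0 -> (0 < ip x (dual_root a)) = (0 < ip x a).
Proof.
by move=> /ip_gt0 h; rewrite ip_dual_root pmulr_rgt0 // divr_gt0.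
Qed.

Lemma dual_rootN a : dual_root (- a) = - dual_root a.
Proof. by rewrite !dual_root_unfold !ipE opprK scalerN. Qed.

Lemma reflectionN a x : reflection a (- x) = - reflection a x.
Proof. by rewrite /reflection !ipE scaleNr opprK opprB addrC. Qed.

Lemma reflectionD a x y :
  reflection a (x + y) = reflection a x + reflection a y.
Proof. by rewrite /reflection !ipE scalerDl opprD addrACA. Qed.

Lemma reflectionZ a k x : reflection a (k *: x) = k *: reflection a x.
Proof. by rewrite /reflection !ipE scalerBr scalerA. Qed.

Lemma reflection_id a : a != 0 -> reflection a a = - a.
Proof.
move=> a0; rewrite /reflection ip_dual_root_id // -[X in X - _]scale1r
  -scalerBl -scaleN1r.
by congr (_ *: _); lra.
Qed.

Lemma reflectionNl a x : reflection (- a) x = reflection a x.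
Proof. by rewrite /reflection dual_rootN !ipE scaleNr scalerN opprK. Qed.

Lemma reflection_ip a x y : a != 0 ->
  ip (reflection a x) (reflection a y) = ip x y.
Proof.
move=> a0; have := ip_gt0 a0;
  rewrite /reflection !ipE !ip_dual_root (ipC a y) => h.
by field; rewrite gt_eqF.
Qed.

Lemma reflectionK a x : a != 0 -> reflection a (reflection a x) = x.
Proof.
move=> a0; rewrite {1}/reflection !ipE ip_dual_root_id // /reflection -addrA
  -opprD -scalerDl.
have -> : ip x (dual_root a) + (ip x (dual_root a) - ip x (dual_root a) * 2) =
  0 by ring.
by rewrite scale0r subr0.
Qed.

Lemma reflection_conj a b x : b != 0 ->
  reflection (reflection b a) (reflection b x) = reflection b (reflection a x).
Proof.
move=> b0; rewrite [reflection (reflection b a) _]/reflection [reflection a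
  x]/reflection reflectionD reflectionN reflectionZ.
by rewrite !ip_dual_root !reflection_ip.
Qed.

(** * Root systems with a base *)

(** A reduced crystallographic root system of which the standard unit vectors
    form a base: the coordinates of a vector are its coordinates on the simple
    roots. *)
Record root_system (D : V -> Prop) : Prop := RootSystem {
  rs_neq0 : forall a, D a -> a != 0;
  rs_sgn : forall a, D a -> root_le 0 a \/ root_le 0 (- a);
  rs_simple : forall i, D (delta_mx 0 i);
  rs_int : forall a b, D a -> D b -> ip b (dual_root a) \is a Num.int;
  rs_reflection : forall a b, D a -> D b -> D (reflection a b);
  rs_reduced : forall a, D a -> ~ D (a *+ 2) }.

Variables (D : V -> Prop) (rsD : root_system D).

Lemma rs_opp a : D a -> D (- a).
Proof.
by move=> Da; rewrite -reflection_id ?(rs_neq0 rsD Da) //; apply: rs_reflection.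
Qed.

Lemma root_coord_int (a : V) i : D a -> a 0 i \is a Num.int.
Proof.
move=> Da; case: (rs_sgn rsD Da) => -[m /(_ i)]; rewrite !mxE subr0.
  by move=> ->; rewrite rpred_nat.
by move=> /(canRL (@opprK _)) ->; rewrite rpredN rpred_nat.
Qed.

Definition pos_root (a : V) := D a /\ root_le 0 a.

Lemma root_le0P (x : V) : root_le 0 x -> forall i, 0 <= x 0 i.
Proof. by case=> m h i; have := h i; rewrite mxE subr0 => ->. Qed.

Lemma pos_rootP a : pos_root a <-> D a /\ (forall i, 0 <= a 0 i).
Proof.
split=> -[Da h]; first by split=> // i; apply: root_le0P.
split=> //; exists (fun i => Num.truncn (a 0 i)) => i.
rewrite mxE subr0; have := h i.
by have /intrP[[m|m] ->] := root_coord_int i Da; rewrite ?ler0z // => _;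
  rewrite Num.Theory.natrK.
Qed.

Lemma pos_root_or a : D a -> pos_root a \/ pos_root (- a).
Proof.
move=> Da; case: (rs_sgn rsD Da) => h; [left|right]; split=> //.
exact: rs_opp.
Qed.

Lemma pos_root_oppF a : pos_root a -> ~ pos_root (- a).
Proof.
move=> /pos_rootP[Da h] /pos_rootP[_ h']; have := rs_neq0 rsD Da; case/negP.
apply/eqP/rowP => i; apply/eqP; rewrite mxE eq_le h andbT.
by have := h' i; rewrite mxE oppr_ge0.
Qed.

Lemma pos_rootN a : D a -> ~ pos_root a -> pos_root (- a).
Proof. by move=> /pos_root_or[]. Qed.

Lemma int_gt0 (x : R) : x \is a Num.int -> 0 < x -> 1 <= x.
Proof. by move=> /intrP[m ->]; rewrite ltr0z -[1]/(1%:~R) ler_int. Qed.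

Lemma int_lt (x y : R) : x \is a Num.int -> y \is a Num.int ->
  x < y -> x + 1 <= y.
Proof.
move=> xi yi h; have : 1 <= y - x by apply: int_gt0; rewrite ?rpredB ?subr_gt0.
by rewrite lerBrDr addrC.
Qed.

(** If both Cartan integers of a and b were at least 2, then |a - b|^2 <= 0.
    So one of them is 1, and a - b is up to sign a reflection of a or b. *)
Lemma root_sub a b : D a -> D b -> 0 < ip a b -> a <> b -> D (a - b).
Proof.
move=> Da Db h neq; have a0 := rs_neq0 rsD Da; have b0 := rs_neq0 rsD Db.
have aa := ip_gt0 a0; have bb := ip_gt0 b0.
have [|] := ltP (ip a (dual_root b)) 2 => hb.
  have hb1 : ip a (dual_root b) = 1.
    apply/eqP; rewrite eq_le; have := rs_int rsD Db Da => /int_gt0.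
    rewrite ip_dual_root_gt0 // h => /(_ isT) ->; rewrite andbT.
    have := int_lt (rs_int rsD Db Da) (rpred_nat _ 2) hb; lra.
  by have := rs_reflection rsD Db Da; rewrite /reflection hb1 scale1r.
have [|] := ltP (ip b (dual_root a)) 2 => ha.
  have ha1 : ip b (dual_root a) = 1.
    apply/eqP; rewrite eq_le; have := rs_int rsD Da Db => /int_gt0.
    rewrite ip_dual_root_gt0 // ipC h => /(_ isT) ->; rewrite andbT.
    have := int_lt (rs_int rsD Da Db) (rpred_nat _ 2) ha; lra.
  have := rs_reflection rsD Da Db; rewrite /reflection ha1 scale1r => /rs_opp.
  by rewrite opprB.
case: neq; apply/eqP; rewrite -subr_eq0; apply/negPn/negP => /ip_gt0.
rewrite !ip_dual_root in ha hb; rewrite !ipE (ipC b a).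
move: hb ha; rewrite mulrAC ler_pdivlMr // mulrAC ler_pdivlMr // (ipC b a).
lra.
Qed.

Lemma root_add a b : D a -> D b -> ip a b < 0 -> a <> - b -> D (a + b).
Proof.
move=> Da Db h neq; rewrite -[b]opprK; apply: root_sub => //.
  exact: rs_opp.
by rewrite ipNr oppr_gt0.
Qed.

Lemma dual_rootZ a (k : R) : k != 0 -> dual_root (k *: a) = k^-1 *: dual_root a.
Proof.
move=> k0; rewrite !dual_root_unfold !ipE !scalerA; congr (_ *: _).
have [->|/eqP a0] := eqVneq a 0;
  first by rewrite ip0l !mulr0 invr0 !mulr0 ?mul0r ?mulr0.
field; rewrite k0 gt_eqF // ip_gt0 //; exact/eqP.
Qed.

(** Both k and 2 / k, the Cartan integer of a with respect to k a, are integers,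
    so k is 1 or 2, and 2 is excluded because the system is reduced. *)
Lemma root_multiple a (k : R) : D a -> D (k *: a) -> 0 < k ->
  k \is a Num.int -> k = 1.
Proof.
move=> Da Dk k0 ki; have a0 := rs_neq0 rsD Da.
have := rs_int rsD Dk Da;
  rewrite dual_rootZ ?gt_eqF // !ipE ip_dual_root_id // => h.
have k1 := int_gt0 ki k0.
have [k2|k2] := ltP k 2.
  apply/eqP; rewrite eq_le k1 andbT.
  by have := int_lt ki (rpred_nat _ 2) k2; lra.
have h1 : 1 <= k^-1 * 2 by apply: int_gt0 => //; rewrite mulr_gt0 ?invr_gt0.
have kE : k = 2.
  apply/eqP; rewrite eq_le k2 andbT.
  by move: h1; rewrite mulrC ler_pdivlMr // mul1r.
by move: Dk; rewrite kE scaler_nat => /(rs_reduced rsD Da).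
Qed.

Local Notation e i := (delta_mx 0 i : V).

Lemma simple_sum (x : V) : x = \sum_i x 0 i *: e i.
Proof. exact: row_sum_delta. Qed.

Lemma ip_coord x y : ip x y = \sum_i y 0 i * ip x (e i).
Proof.
by rewrite {1}(simple_sum y) ip_sumr; apply: eq_bigr => i _; rewrite ipZr.
Qed.

Lemma simple_pos i : pos_root (e i).
Proof.
apply/pos_rootP; split; first exact: rs_simple.
by move=> j; rewrite mxE; case: (_ && _).
Qed.

Lemma pos_is_root a : pos_root a -> D a. Proof. by case. Qed.
Lemma pos_root_ge0 a i : pos_root a -> 0 <= a 0 i.
Proof. by case/pos_rootP. Qed.
Lemma pos_root_int a i : pos_root a -> a 0 i \is a Num.int.
Proof. by case=> Da _; apply: root_coord_int. Qed.
Lemma pos_root_neq0 a : pos_root a -> a != 0.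
Proof. by move/pos_is_root/(rs_neq0 rsD). Qed.
Lemma simple_neq0 i : e i != 0. Proof. exact/pos_root_neq0/simple_pos. Qed.

(** The coordinates of a root have the same sign, so one of them decides. *)
Lemma pos_root_coord a : D a -> (exists i, 0 < a 0 i) -> pos_root a.
Proof.
move=> Da [i hi]; case: (pos_root_or Da) => // /pos_rootP[_ /(_ i)].
by rewrite mxE oppr_ge0 leNgt hi.
Qed.

Lemma pos_root_not_simple a i : pos_root a -> a <> e i ->
  exists2 j, j != i & 0 < a 0 j.
Proof.
move=> pa nai; apply: contrapT => h; apply: nai.
have aj0 j : j != i -> a 0 j = 0.
  move=> ji; apply/eqP; rewrite eq_le pos_root_ge0 // andbT leNgt.
  by apply/negP => hj; apply: h; exists j.
have aE : a = a 0 i *: e i.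
  rewrite {1}(simple_sum a) (bigD1 i) //= big1 ?addr0 // => j /aj0 ->.
  by rewrite scale0r.
suff a1 : a 0 i = 1 by rewrite aE a1 scale1r.
have ai0 : 0 < a 0 i.
  rewrite lt_def pos_root_ge0 // andbT; apply/eqP => z.
  by have := pos_root_neq0 pa; rewrite aE z scale0r eqxx.
apply: (@root_multiple (e i)) => //; first exact: rs_simple.
- by rewrite -aE; apply: pos_is_root.
- exact: pos_root_int.
Qed.

(** A positive root other than e i has a positive coordinate away from i, which
    the reflection leaves unchanged. *)
Lemma reflection_simple_pos a i : pos_root a -> a <> e i ->
  pos_root (reflection (e i) a).
Proof.
move=> pa /(pos_root_not_simple pa)[j ji aj]; apply: pos_root_coord.
  by apply: rs_reflection => //; [apply: rs_simple|apply: pos_is_root].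
exists j; rewrite /reflection !mxE eqxx /= (negbTE ji) mulr0 subr0; exact: aj.
Qed.

(** Expand (a, a) > 0 on the simple roots. *)
Lemma pos_root_ip_simple a : pos_root a ->
  exists2 i, 0 < ip a (e i) & 0 < a 0 i.
Proof.
move=> pa; apply: contrapT => h.
have := ip_gt0 (pos_root_neq0 pa); rewrite ltNge => /negP; apply.
rewrite ip_coord; apply: sumr_le0 => i _.
have := pos_root_ge0 i pa; rewrite le_eqVlt => /orP[/eqP <-|ai];
  first by rewrite mul0r.
by rewrite pmulr_rle0 // leNgt; apply/negP => h1; apply: h; exists i.
Qed.

Lemma pos_root_sub_simple a : pos_root a -> (forall i, a <> e i) ->
  exists2 i, pos_root (a - e i) & 0 < ip a (e i).
Proof.
move=> pa ne; have [i ai _] := pos_root_ip_simple pa; exists i => //.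
have [j ji aj] := pos_root_not_simple pa (ne i).
apply: pos_root_coord; first by apply: root_sub => //;
  [apply: pos_is_root|apply: rs_simple].
by exists j; rewrite !mxE eqxx (negbTE ji) subr0.
Qed.

Definition height (a : V) : R := \sum_i a 0 i.

Lemma heightD a b : height (a + b) = height a + height b.
Proof. by rewrite /height -big_split; apply: eq_bigr => i _; rewrite mxE. Qed.

Lemma heightZ k a : height (k *: a) = k * height a.
Proof. by rewrite /height mulr_sumr; apply: eq_bigr => i _; rewrite mxE. Qed.

Lemma height_simple i : height (e i) = 1.
Proof.
rewrite /height (bigD1 i) //= big1 ?addr0 ?mxE ?eqxx // => j ji.
by rewrite mxE (negbTE ji) andbF.
Qed.

Lemma height_int a : D a -> height a \is a Num.int.
Proof. by move=> Da; apply: rpred_sum => i _; apply: root_coord_int. Qed.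

Lemma height_gt0 a : pos_root a -> 0 < height a.
Proof.
move=> pa; have [i _ ai] := pos_root_ip_simple pa.
rewrite /height (bigD1 i) //=; apply: ltr_wpDr => //.
by apply: sumr_ge0 => j _; apply: pos_root_ge0.
Qed.

Lemma pos_root_height a : pos_root a -> exists k : nat, height a = k%:R.
Proof.
move=> pa; have := height_gt0 pa;
  have /intrP[[m|m] ->] := height_int (pos_is_root pa).
  by exists m.
by rewrite NegzE ltr0z.
Qed.

Lemma pos_root_ind (P : V -> Prop) :
  (forall a, pos_root a ->
    (forall b, pos_root b -> height b < height a -> P b) -> P a) ->
  forall a, pos_root a -> P a.
Proof.
move=> IH a pa; have [k hk] := pos_root_height pa.
elim/ltn_ind: k a pa hk => k IHk a pa hk; apply: IH => // b pb.
have [m hm] := pos_root_height pb; rewrite hk hm ltr_nat => mk; exact: (IHk m).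
Qed.

(** * The Weyl group *)

Definition rword (s : seq 'I_n) : V -> V :=
  foldr (fun i w => reflection (e i) \o w) id s.

Lemma rword_cat s1 s2 x : rword (s1 ++ s2) x = rword s1 (rword s2 x).
Proof. by elim: s1 => //= i s ->. Qed.

Lemma rwordD s x y : rword s (x + y) = rword s x + rword s y.
Proof. by elim: s => //= i s ->; rewrite reflectionD. Qed.

Lemma rwordZ s k x : rword s (k *: x) = k *: rword s x.
Proof. by elim: s => //= i s ->; rewrite reflectionZ. Qed.

Lemma rwordN s x : rword s (- x) = - rword s x.
Proof. by rewrite -scaleN1r rwordZ scaleN1r. Qed.

Lemma rword_ip s x y : ip (rword s x) (rword s y) = ip x y.
Proof. by elim: s => //= i s <-; rewrite reflection_ip // simple_neq0. Qed.

Lemma rword_root s x : D x -> D (rword s x).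
Proof.
by move=> Dx; elim: s => //= i s IH; apply: rs_reflection => //;
  apply: rs_simple.
Qed.

Lemma rword_reflection s a x :
  rword s (reflection a x) = reflection (rword s a) (rword s x).
Proof. by elim: s => //= i s ->; rewrite reflection_conj // simple_neq0. Qed.

Lemma rword_dual_root s a : rword s (dual_root a) = dual_root (rword s a).
Proof. by rewrite !dual_root_unfold rwordZ rword_ip. Qed.

Lemma rwordK s x : rword (rev s) (rword s x) = x.
Proof.
elim: s x => //= i s IH x; rewrite rev_cons -cats1 rword_cat /=.
by rewrite reflectionK ?simple_neq0.
Qed.

Lemma rwordVK s x : rword s (rword (rev s) x) = x.
Proof. by rewrite -{1}[s]revK rwordK. Qed.

Lemma rword_inj s : injective (rword s).
Proof. exact: can_inj (rwordK s). Qed.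

(** Apply the letters of s to e i one by one: at the letter where the root
    becomes negative it was the simple root of that letter. *)
Lemma rword_cross s i : ~ pos_root (rword s (e i)) ->
  exists s1 s2 j, s = s1 ++ j :: s2 /\ rword s2 (e i) = e j.
Proof.
elim: s => [/(_ (simple_pos i))//|j s IH] /= h.
have [ps|/IH[s1 [s2 [k [-> h2]]]]] := pselect (pos_root (rword s (e i))).
  exists [::], s, j; split=> //; apply: contrapT => ne.
  by apply: h; apply: reflection_simple_pos.
by exists (j :: s1), s2, k.
Qed.

(** Exchange argument: if the last letter is i, the letters before it make e i
    negative, so that letter and the one where e i changes sign cancel out, and
    a word with two letters less has the same action. *)
Lemma rword_pos_id s : (forall a, pos_root a -> pos_root (rword s a)) ->
  rword s =1 id.
Proof.
have [k] := ubnP (size s); elim: k s => // k IH s.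
case: (lastP s) => // s' i; rewrite size_rcons ltnS => sk h.
have [|s1 [s2 [j [s'E hj]]]] := @rword_cross s' i.
  move=> p'; have /h := simple_pos i; rewrite -cats1 rword_cat /=.
  by rewrite reflection_id ?simple_neq0 // rwordN => /(pos_root_oppF p').
have sE x : rword (rcons s' i) x = rword (s1 ++ s2) x.
  rewrite -cats1 s'E -catA !rword_cat /= -hj.
  by rewrite -rword_reflection reflectionK ?simple_neq0.
move=> x; rewrite sE; apply: IH => [|a /h]; last by rewrite sE.
by apply: leq_trans sk; rewrite s'E !size_cat /= addnS.
Qed.

(** By induction on the height, conjugating with a simple reflection which
    lowers a. *)
Lemma reflection_rword a : D a -> exists s, reflection a =1 rword s.
Proof.
suff H : forall a, pos_root a -> exists s, reflection a =1 rword s.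
  move=> /pos_root_or[/H//|/H[s hs]]; exists s => x; rewrite -hs.
  by rewrite reflectionNl.
apply: pos_root_ind => b pb IH.
have [[i bi]|ne] := pselect (exists i, b = e i).
  by exists [:: i] => x; rewrite bi.
have {}ne i : b <> e i by move=> h; apply: ne; exists i.
have [i _ bi] := pos_root_sub_simple pb ne.
have p' := reflection_simple_pos pb (ne i).
have [|s hs] := IH _ p'.
  have c0 : 0 < ip b (dual_root (e i)) by rewrite ip_dual_root_gt0 ?simple_neq0.
  by rewrite /reflection -scaleNr heightD heightZ height_simple; lra.
exists (i :: s ++ [:: i]) => x /=; rewrite rword_cat /= -hs.
by rewrite reflection_conj ?simple_neq0 // reflectionK ?simple_neq0.
Qed.

(** * The coroot lattice *)

(** Sums of coroots of arbitrary roots.  The opposite of a coroot being a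
    coroot, these sums form a group, and the number of summands is available
    for induction. *)
Definition colattice (r : V) : Prop :=
  exists2 s : seq V, (forall a, a \in s -> D a) & r = \sum_(a <- s) dual_root a.

Lemma colattice_int r a : colattice r -> D a -> ip a r \is a Num.int.
Proof.
move=> [s hs ->] Da; rewrite ip_sumr big_seq; apply: rpred_sum => b /hs Db.
exact: (rs_int rsD).
Qed.

Lemma colatticeD r r' : colattice r -> colattice r' -> colattice (r + r').
Proof.
move=> [s hs ->] [s' hs' ->]; exists (s ++ s'); last by rewrite big_cat.
by move=> a; rewrite mem_cat => /orP[/hs|/hs'].
Qed.

Lemma colattice0 : colattice 0.
Proof. by exists [::] => //; rewrite big_nil. Qed.

Lemma colattice_dual_root a : D a -> colattice (dual_root a).
Proof.
move=> Da; exists [:: a]; last by rewrite big_seq1.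
by move=> b; rewrite inE => /eqP ->.
Qed.

Lemma colatticeN r : colattice r -> colattice (- r).
Proof.
move=> [s hs ->]; exists (map -%R s).
  by move=> a /mapP[b /hs Db ->]; apply: rs_opp.
by rewrite big_map -sumrN; apply: eq_bigr => a _; rewrite dual_rootN.
Qed.

Lemma colatticeZ r (m : int) : colattice r -> colattice (m%:~R *: r).
Proof.
move=> h; have hn k : colattice (k%:R *: r).
  elim: k => [|k IH]; first by rewrite scale0r; apply: colattice0.
  by rewrite -natr1 scalerDl scale1r; apply: colatticeD.
case: m => m; first exact: hn.
by rewrite NegzE rmorphN scaleNr; apply/colatticeN/hn.
Qed.

Lemma colattice_sum I (s : seq I) (F : I -> V) :
  (forall i, colattice (F i)) -> colattice (\sum_(i <- s) F i).
Proof.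
by move=> h; elim/big_ind: _ => //; [apply: colattice0|apply: colatticeD].
Qed.

(** Induction on the number of summands.  If r is not zero, (r, r) > 0 gives a
    summand p^v with (r, p) > 0, hence (r, p) = 1.  Then r - p^v = s_p(r)
    satisfies the same bounds and has one summand less, so it vanishes, and
    r = p^v contradicts (p, r) <= 1. *)
Lemma colattice_minuscule r : colattice r ->
  (forall a, D a -> ip a r <= 1) -> r = 0.
Proof.
move=> [s]; have [k] := ubnP (size s); elim: k s r => // k IH s r.
rewrite ltnS => sk hs rE h1; apply: contrapT => /eqP r0.
have [p ps rp] : exists2 p, p \in s & 0 < ip r p.
  apply: contrapT => h; have := ip_gt0 r0; rewrite ltNge => /negP; apply.
  rewrite {2}rE ip_sumr big_seq; apply: sumr_le0 => p ps.
  rewrite leNgt ip_dual_root_gt0 ?(rs_neq0 rsD (hs _ ps)) //.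
  by apply/negP => rp; apply: h; exists p.
have Dp := hs _ ps; have p0 := rs_neq0 rsD Dp.
have pr1 : ip r p = 1.
  apply/eqP; rewrite eq_le ipC h1 //=; apply: int_gt0; last by rewrite ipC.
  by apply: (colattice_int _ Dp); exists s.
have rpE : r - dual_root p = reflection p r.
  by rewrite /reflection ip_dual_root pr1 mulr1 dual_root_unfold.
have : r - dual_root p = 0.
  apply: (IH (rem p s)).
  - by rewrite size_rem //; case: (s) ps sk.
  - by move=> a /mem_rem/hs.
  - by rewrite rE (perm_big _ (perm_to_rem ps)) big_cons addrC addKr.
  - move=> a Da; rewrite rpE -(reflection_ip _ _ p0) reflectionK //; apply: h1.
    exact: (rs_reflection rsD).
move=> /subr0_eq rE'; have := ip_dual_root_id p0; rewrite -rE' ipC pr1; lra.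
Qed.

(** * The highest root *)

Section Affine.
Variables (theta : V) (th_pos : pos_root theta).
Hypothesis th_max : forall a, pos_root a -> root_le a theta.

Lemma theta_ge a i : pos_root a -> a 0 i <= theta 0 i.
Proof. by move=> /th_max[m /(_ i) h]; rewrite -subr_ge0 h ler0n. Qed.

Lemma theta_neq0 : theta != 0. Proof. exact: pos_root_neq0. Qed.

(** Otherwise a + theta would be a root above theta. *)
Lemma theta_dominant a : pos_root a -> 0 <= ip a theta.
Proof.
move=> pa; rewrite leNgt; apply/negP => h.
have Da : D (a + theta).
  apply: root_add => //; [exact: pos_is_root|exact: pos_is_root|move=> aE].
  by apply: (pos_root_oppF th_pos); rewrite -aE.
have [i _ ai] := pos_root_ip_simple pa.
have pb : pos_root (a + theta).
  by apply: pos_root_coord => //; exists i;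
    rewrite mxE ltr_pwDl // pos_root_ge0.
by have := theta_ge i pb; rewrite mxE gerDr leNgt ai.
Qed.

Lemma pos_root_of_ip a : D a -> 0 < ip a theta -> pos_root a.
Proof.
move=> Da h; apply: contrapT => /(pos_rootN Da)/theta_dominant.
by rewrite ipNl oppr_ge0 leNgt h.
Qed.

(** With c = (a, theta^v), the root c theta - a is positive and at most theta,
    so (c - 1) theta <= a; when c >= 2 this gives theta <= a. *)
Lemma theta_level2 a : pos_root a -> 2 <= ip a (dual_root theta) -> a = theta.
Proof.
move=> pa c2; set c := ip a (dual_root theta) in c2.
have pb : pos_root (- reflection theta a).
  apply/pos_rootP; split.
    by apply: rs_opp; apply: (rs_reflection rsD); apply: pos_is_root.
  move=> i; rewrite /reflection -/c !mxE opprB subr_ge0.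
  have := theta_ge i pa; have := pos_root_ge0 i th_pos; nra.
apply/rowP => i; apply/eqP; rewrite eq_le theta_ge //=.
have := theta_ge i pb; rewrite /reflection -/c !mxE.
have := pos_root_ge0 i th_pos; nra.
Qed.

Lemma theta_level_int a : D a -> ip a (dual_root theta) \is a Num.int.
Proof. by move=> Da; apply: (rs_int rsD) => //; apply: pos_is_root. Qed.

Lemma theta_level_ge0 a : pos_root a -> 0 <= ip a (dual_root theta).
Proof.
by move=> /theta_dominant h;
  rewrite ip_dual_root mulr_ge0 // divr_ge0 // ltW ?ip_gt0 ?theta_neq0.
Qed.

Lemma theta_level01 a : pos_root a -> a <> theta ->
  ip a (dual_root theta) = 0 \/ ip a (dual_root theta) = 1.
Proof.
move=> pa ne; have ci := theta_level_int (pos_is_root pa);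
  have c0 := theta_level_ge0 pa.
have c2 : ip a (dual_root theta) < 2 by rewrite ltNge;
  apply/negP => /(theta_level2 pa).
have := int_lt ci (rpred_nat _ 2) c2.
move: c0; rewrite le_eqVlt => /orP[/eqP|/(int_gt0 ci)]; [left|right] => //.
by apply/eqP; rewrite eq_le; lra.
Qed.

(** If b is not dominant a simple root can be added to it.  If b is dominant,
    (b, theta) >= (b, b) > 0 because theta - b is a nonnegative combination of
    simple roots, and theta - b itself is a root to add. *)
Lemma pos_root_raise b : pos_root b -> b <> theta ->
  exists2 c, pos_root c & pos_root (b + c).
Proof.
move=> pb ne; have [[i bi]|dom] := pselect (exists i, ip b (e i) < 0).
  exists (e i); first exact: simple_pos.
  have Dbi : D (b + e i).
    apply: root_add => //; [exact: pos_is_root|exact: rs_simple|move=> bE].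
    by apply: (pos_root_oppF (simple_pos i)); rewrite -bE.
  have [j _ bj] := pos_root_ip_simple pb.
  by apply: pos_root_coord => //; exists j; rewrite mxE ltr_pwDl //;
    apply/pos_root_ge0/simple_pos.
exists (theta - b); last by rewrite addrC subrK.
have Dth : D (theta - b).
  apply: root_sub; [exact: pos_is_root|exact: pos_is_root| |exact/nesym].
  apply: lt_le_trans (ip_gt0 (pos_root_neq0 pb)) _; rewrite ipC.
  rewrite -subr_ge0 -ipBr ip_coord; apply: sumr_ge0 => i _; apply: mulr_ge0.
    by rewrite !mxE subr_ge0 theta_ge.
  by rewrite leNgt; apply/negP => h; apply: dom; exists i.
by apply/pos_rootP; split=> // i; rewrite !mxE subr_ge0 theta_ge.
Qed.

(** * Affine roots *)

(** The pair (x, k) stands for the vector x + k delta; affpos singles out the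
    positive affine roots. *)
Definition affpos (p : V * R) : Prop :=
  [/\ D p.1, p.2 \is a Num.int & 0 < p.2 \/ p.2 = 0 /\ pos_root p.1].

Lemma affpos_ge0 p : affpos p -> 0 <= p.2.
Proof. by case=> _ _ [/ltW|[->]]. Qed.

Lemma affposN p : D p.1 -> p.2 \is a Num.int -> ~ affpos p -> affpos (- p).
Proof.
case: p => x k /= Dx ki np; split; [exact: rs_opp|by rewrite rpredN|].
rewrite /= oppr_gt0; case: (ltgtP k 0) => h; first by left.
  by case: np; split=> //; left.
right; split; first by rewrite h oppr0.
by apply: pos_rootN => // px; apply: np; split=> //; right.
Qed.

Lemma affpos_oppF p : affpos p -> ~ affpos (- p).
Proof.
case: p => x k [/= _ _ h] [/= _ _]; rewrite oppr_gt0.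
case: h => [k0|[-> px]]; case.
- by rewrite ltNge (ltW k0).
- by move=> [/eqP]; rewrite oppr_eq0 gt_eqF.
- by rewrite ltxx.
- by move=> [_ /(pos_root_oppF px)].
Qed.

Lemma affpos_finite a : pos_root a -> affpos (a, 0).
Proof. by move=> pa; split; [apply: pos_is_root|rewrite rpred0|right]. Qed.

Lemma affpos_level a k : D a -> (0 < k)%N -> affpos (a, k%:R).
Proof. by move=> Da k0; split=> //=; left; rewrite ltr0n. Qed.

Definition affine_simple (i : option 'I_n) : V * R :=
  if i is Some j then (e j, 0) else (- theta, 1).

(** The reflection in delta - theta acts on V + R delta as the reflection in
    theta followed by a shift of the level. *)
Definition affine_reflection (i : option 'I_n) (p : V * R) : V * R :=
  if i is Some j then (reflection (e j) p.1, p.2)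
  else (reflection theta p.1, p.2 + ip p.1 (dual_root theta)).

Lemma affine_reflectionN i p :
  affine_reflection i (- p) = - affine_reflection i p.
Proof.
by case: i p => [j|] [x k] /=;
  rewrite /affine_reflection reflectionN //= ipNl -opprD.
Qed.

Lemma affine_reflection_simple i :
  affine_reflection i (affine_simple i) = - affine_simple i.
Proof.
case: i => [j|] /=; first by rewrite reflection_id ?simple_neq0 //;
  congr pair; rewrite oppr0.
rewrite reflectionN reflection_id ?theta_neq0 // ipNl ip_dual_root_id
  ?theta_neq0 //.
by congr pair => /=; lra.
Qed.

Lemma affine_reflectionK i p : affine_reflection i (affine_reflection i p) = p.
Proof.
case: i p => [j|] [x k] /=; rewrite reflectionK ?simple_neq0 ?theta_neq0 //.
congr pair; rewrite -addrA /reflection ipBl ipZl ip_dual_root_id ?theta_neq0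
  //; ring.
Qed.

(** For the affine node, the level of (x, k) becomes k + (x, theta^v).  It can
    only drop below k when - x is positive; it drops by 2 for - x = theta alone,
    and by 1 to the level 0 in a case where the new root theta - (- x) pairs
    positively with theta and so is positive. *)
Lemma affine_reflection_pos i p : affpos p -> p <> affine_simple i ->
  affpos (affine_reflection i p).
Proof.
case: i p => [j|] [x k] [/= Dx ki hk] ne.
  split=> //=; first by apply: (rs_reflection rsD) => //; apply: rs_simple.
  case: hk => [|[k0 px]]; [by left|right; split=> //].
  by apply: reflection_simple_pos => // xE; apply: ne; rewrite xE k0.
have Dth := pos_is_root th_pos; have ci := theta_level_int Dx.
split=> /=; [exact: (rs_reflection rsD)|by rewrite rpredD|].
have [px|/(pos_rootN Dx) px] := pselect (pos_root x).
  have := theta_level_ge0 px; rewrite le_eqVlt => /orP[/eqP c0|c0].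
    by rewrite /reflection -c0 scale0r subr0 addr0.
  by left; case: hk => [k0|[-> _]]; rewrite ?add0r // addr_gt0.
have {}hk : 1 <= k.
  by apply: int_gt0 => //; case: hk => // -[_ /pos_root_oppF].
have cE : ip x (dual_root theta) =
  - ip (- x) (dual_root theta) by rewrite ipNl opprK.
have [xth|nxth] := pselect (- x = theta).
  have k1 : 1 < k.
    rewrite lt_neqAle hk andbT; apply/eqP => kE; apply: ne.
    by rewrite -kE -xth opprK.
  have := int_lt (rpred1 _) ki k1 => k2.
  rewrite cE xth ip_dual_root_id ?theta_neq0 //.
  have xE : x = - theta by rewrite -xth opprK.
  rewrite xE reflectionN reflection_id ?theta_neq0 // opprK.
  by case: (ltgtP k 2) => [|k3|->]; [lra|left; lra|right; split; [lra|]].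
case: (theta_level01 px nxth) => c; rewrite cE c ?subr0; first by left; lra.
case: (ltgtP k 1) => [|k3|kE]; [lra|left; lra|right; split;
  first by rewrite kE subrr].
apply: pos_root_of_ip; first exact: (rs_reflection rsD).
rewrite /reflection cE c scaleN1r opprK ipDl -(opprK x) ipNl.
have thth := ip_gt0 theta_neq0.
have : ip (- x) (dual_root theta) * ip theta theta = 2 * ip (- x) theta.
  by rewrite ip_dual_root; field; rewrite gt_eqF.
rewrite c; lra.
Qed.

Definition affine_word (s : seq (option 'I_n)) : V * R -> V * R :=
  foldr (fun i w => affine_reflection i \o w) id s.

(** The action of v t_r on V + R delta, for v given by the word s. *)
Definition affine_act (s : seq 'I_n) (r : V) (p : V * R) : V * R :=
  (rword s p.1, p.2 - ip p.1 r).

(** The affine generator is s_theta t_(- theta^v), where s_theta belongs to the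
    finite Weyl group, and t_a v = v t_(v^-1 a). *)
Lemma affine_word_decomp s : exists vs r,
  colattice r /\ affine_word s =1 affine_act vs r.
Proof.
elim: s => [|i s [vs [r [cr IH]]]].
  exists [::], 0; split; first exact: colattice0.
  by case=> x k; rewrite /affine_act /= ip0r subr0.
case: i => [j|].
  by exists (j :: vs), r; split=> // p; rewrite /= IH.
have [ss hs] := reflection_rword (pos_is_root th_pos).
exists (ss ++ vs), (r - rword (rev vs) (dual_root theta)); split.
  apply: colatticeD => //; apply: colatticeN; rewrite rword_dual_root;
    apply: colattice_dual_root.
  by apply: rword_root; apply: pos_is_root.
case=> x k; rewrite /= IH /affine_act /= hs rword_cat ipBr opprB; congr pair.
rewrite -[in RHS](rword_ip vs x) rwordVK; ring.
Qed.

Lemma affpos_simple i : affpos (affine_simple i).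
Proof.
case: i => [j|] /=; first exact: affpos_finite (simple_pos j).
by split; [exact/rs_opp/pos_is_root|exact: rpred1|left; exact: ltr01].
Qed.

Lemma affine_actN s r p : affine_act s r (- p) = - affine_act s r p.
Proof. by case: p => x k; rewrite /affine_act /= rwordN ipNl -opprD. Qed.

Lemma affine_actD s r p q :
  affine_act s r (p + q) = affine_act s r p + affine_act s r q.
Proof.
by case: p q => x k [y l]; rewrite /affine_act /= rwordD ipDl opprD addrACA.
Qed.

Lemma affine_act_inj s r : injective (affine_act s r).
Proof.
move=> [x k] [y l] [/rword_inj ->]; rewrite /= => /addIr -> //.
Qed.

Lemma affine_act_root s r p : D p.1 -> D (affine_act s r p).1.
Proof. exact: rword_root. Qed.

Lemma affine_act_int s r p : colattice r -> D p.1 -> p.2 \is a Num.int ->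
  (affine_act s r p).2 \is a Num.int.
Proof. by move=> cr Dp pi; rewrite rpredB //; apply: colattice_int. Qed.

Lemma affine_act_surj s r p : colattice r -> D p.1 -> p.2 \is a Num.int ->
  exists q, [/\ D q.1, q.2 \is a Num.int & affine_act s r q = p].
Proof.
case: p => x k cr /= Dx ki.
exists (rword (rev s) x, k + ip (rword (rev s) x) r); split=> /=.
- exact: rword_root.
- by rewrite rpredD // colattice_int //; apply: rword_root.
- by rewrite /affine_act /= rwordVK addrK.
Qed.

(** * Minuscule elements *)

(** The defining property of the minuscule element of the ideal with set of
    roots J, the root delta - gamma being the pair (- gamma, 1). *)
Local Notation minuscule_for w J := (forall p, affpos p ->
  affpos (- (w p)) <-> p.2 = 1 /\ J (- p.1)).

Section Minuscule.
Variables (vs : seq 'I_n) (r : V) (J : V -> Prop).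
Hypotheses (cr : colattice r).
Local Notation w := (affine_act vs r).
Hypothesis (wJ : minuscule_for w J).

Lemma minuscule_keep p : affpos p -> ~ (p.2 = 1 /\ J (- p.1)) -> affpos (w p).
Proof.
move=> ap nJ; apply: contrapT => /affposN h; apply: nJ; apply/wJ => //.
by case: (ap) => Dp pi _; apply: h;
  [apply: affine_act_root|apply: affine_act_int].
Qed.

Lemma minuscule_flip a : pos_root a -> J a ->
  affpos (rword vs a, - (1 + ip a r)).
Proof.
move=> pa Ja; have /wJ[_ /=] :=
  affpos_level (rs_opp (pos_is_root pa)) (ltn0Sn 0).
rewrite opprK => /(_ (conj erefl Ja)); congr affpos; congr pair => /=.
  by rewrite rwordN opprK.
by rewrite ipNl opprK.
Qed.

Lemma minuscule_le0 a : pos_root a -> ip a r <= 0.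
Proof.
move=> pa; have /minuscule_keep := affpos_finite pa.
move=> /(_ _)/affpos_ge0; rewrite /= sub0r oppr_ge0; apply.
by case=> /eqP; rewrite eq_sym oner_eq0.
Qed.

(** theta - a is a nonnegative combination of simple roots, on all of which r
    is nonpositive. *)
Lemma minuscule_ge_theta a : pos_root a -> ip theta r <= ip a r.
Proof.
move=> pa; rewrite -subr_le0 -ipBl ipC ip_coord; apply: sumr_le0 => i _.
apply: mulr_ge0_le0; last by rewrite ipC minuscule_le0 //; apply: simple_pos.
by rewrite !mxE subr_ge0 theta_ge.
Qed.

(** The levels of delta - theta and 2 delta - theta leave -1 and -2.  If the
    value were -1, all roots would pair with r within [-1, 1], whence r = 0. *)
Lemma minuscule_theta : J theta -> ip theta r = - 2.
Proof.
move=> Jth; have := affpos_ge0 (minuscule_flip th_pos Jth);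
  rewrite /= oppr_ge0 => h1.
have h2 : -2 <= ip theta r.
  have /minuscule_keep/(_ _)/affpos_ge0 :=
    affpos_level (rs_opp (pos_is_root th_pos)) (ltn0Sn 1).
  rewrite /= ipNl opprK => h; suff : 0 <= 2 - - ip theta r by lra.
  by apply: h => -[/eqP]; rewrite pnatr_eq1.
apply/eqP; rewrite eq_le h2 andbT leNgt; apply/negP => h3.
have thi := colattice_int cr (pos_is_root th_pos).
have h4 : ip theta r = -1.
  have := int_lt (rpredN1 _) thi; have := int_lt _ thi h3.
  by rewrite rpredN rpred_nat => /(_ isT) h4 _; lra.
have : r = 0.
  apply: colattice_minuscule => // a /pos_root_or[pa|pa].
    by apply: le_trans (minuscule_le0 pa) _.
  by have := minuscule_ge_theta pa; rewrite ipNl h4; lra.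
by move=> r0; move: h4; rewrite r0 ip0r; lra.
Qed.

(** A positive root a has level 0, 1 or 2 against theta^v, and - a + delta stays
    positive under w if a has level 0; in each case the bounds on (a, r) place
    (a, r + theta^v) within [-1, 1]. *)
Lemma minuscule_translation : J theta -> (forall a, pos_root a -> J a ->
  0 < ip a theta) ->
  r = - dual_root theta.
Proof.
move=> Jth JH; apply/eqP; rewrite -addr_eq0; apply/eqP.
suff H a : pos_root a -> -1 <= ip a (r + dual_root theta) <= 1.
  apply: colattice_minuscule => [|a /pos_root_or[/H/andP[]//|/H]].
    by apply: colatticeD => //; apply/colattice_dual_root/pos_is_root.
  by rewrite ipNl; lra.
move=> pa; have hth := minuscule_theta Jth.
have [->|ne] := pselect (a = theta).
  by rewrite ipDr hth ip_dual_root_id ?theta_neq0 //; lra.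
rewrite ipDr; have := minuscule_le0 pa.
case: (theta_level01 pa ne) => c ar0; rewrite c; last first.
  by have := minuscule_ge_theta pa; rewrite hth; lra.
have : 0 <= 1 + ip a r.
  have := affpos_level (rs_opp (pos_is_root pa)) (ltn0Sn 0) =>
    /minuscule_keep/(_ _)/affpos_ge0.
  rewrite /= ipNl !opprK; apply => -[_ /(JH _ pa)].
  by rewrite -ip_dual_root_gt0 ?theta_neq0 // c ltxx.
lra.
Qed.

Lemma minuscule_level a : r = - dual_root theta -> pos_root a -> J a ->
  0 < ip a theta.
Proof.
move=> rE pa /(minuscule_flip pa)/affpos_ge0 /=.
rewrite rE ipNr oppr_ge0 -(ip_dual_root_gt0 _ theta_neq0); lra.
Qed.

(** Pull p and q back by w.  Either preimage is positive, or of the form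
    (b, -1) with b in J.  The levels add up to -1, so exactly one is of the
    second kind and the other one is the positive root c - b at level 0. *)
Lemma minuscule_indecomposable c p q : pos_root c -> J c ->
  (forall b, J b -> ~ pos_root (c - b)) ->
  affpos p -> affpos q -> w (c, - 1) <> p + q.
Proof.
move=> pc Jc low ap aq.
have lvl0 (k l : R) : -1 = k + l -> l = -1 -> k = 0 by lra.
have lvl1 (k l : R) : 0 <= k -> 0 <= l -> -1 <> k + l by lra.
have lvl2 (k l : R) : k = -1 -> l = -1 -> -1 <> k + l by lra.
have back u : affpos (w u) -> D u.1 -> u.2 \is a Num.int ->
    affpos u \/ (u.2 = -1 /\ J u.1).
  move=> aw Du iu; have [|nu] := pselect (affpos u); [by left|right].
  have /wJ := affposN Du iu nu; rewrite affine_actN opprK => -[/(_ aw)[h Ju] _].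
  by split; [rewrite -h opprK|rewrite -[u.1]opprK].
have [Dp pi _] := ap; have [Dq qi _] := aq.
have [u [Du ui up]] := affine_act_surj vs cr Dp pi.
have [v [Dv vi vq]] := affine_act_surj vs cr Dq qi.
rewrite -up -vq -affine_actD => /affine_act_inj.
rewrite -up in ap; rewrite -vq in aq.
have [hu hv] := (back _ ap Du ui, back _ aq Dv vi).
move: hu hv; case: (u) (v) => [x k] [y l] /= hx hy [cE kl].
case: hx hy => [ax|[k1 Jx]] [ay|[l1 Jy]].
- exact: lvl1 (affpos_ge0 ax) (affpos_ge0 ay) kl.
- rewrite (lvl0 _ _ kl l1) in ax; case: ax => _ _ [|[_ px]];
  first by rewrite ltxx.
  by apply: (low y) => //; rewrite cE addrK.
- rewrite addrC in kl; rewrite (lvl0 _ _ kl k1) in ay.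
  case: ay => _ _ [|[_ py]]; first by rewrite ltxx.
  by apply: (low x) => //; rewrite cE addrC addKr.
- exact: lvl2 k1 l1 kl.
Qed.

(** The positive root - w(delta - c) is not delta plus a positive root, for
    then 2 delta - c would be inverted too; so it is a finite root or of the
    form delta - d.  If it were not simple it would be a sum of two positive
    roots: a finite root splits off a simple root, and
    delta - d = (delta - (d + a)) + a for a positive root a given by
    pos_root_raise. *)
Lemma minuscule_lowest c : pos_root c -> J c -> (forall b, J b ->
  ~ pos_root (c - b)) ->
  exists i, w (c, -1) = affine_simple i.
Proof.
move=> pc Jc low; have split2 p q := @minuscule_indecomposable c p q pc Jc low.
have : affpos (w (c, -1)).
  by have := minuscule_flip pc Jc; congr affpos; congr pair => /=; ring.
have : ~ affpos (w (c, -1) - (0, 1)).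
  move=> ap; have : w (c, -1) - (0, 1) = w (c, -2).
    by rewrite /affine_act /=; congr pair; rewrite /= ?subr0 //; ring.
  move=> wE; rewrite wE in ap.
  have a2 : affpos (- c, 2%:R) by apply: affpos_level => //;
    apply/rs_opp/pos_is_root.
  have /wJ[+ _] := a2; rewrite -affine_actN /= => h.
  have [] : (2%:R : R) = 1 /\ J (- - c).
    by apply: h; move: ap; congr affpos; congr affine_act; congr pair;
      rewrite opprK.
  by move=> /eqP; rewrite pnatr_eq1.
case wE: (w (c, -1)) => [b k] h1 [/= Db ki hk].
have lvl l x : D x -> l = 0 \/ 0 < l -> l \is a Num.int -> (l = 0 ->
  pos_root x) -> affpos (x, l).
  by move=> Dx hl li hx; split=> //=; case: hl => [l0|]; [right; split=> //;
    apply: hx|left].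
case: hk => [k0|[k0 pb]]; last first.
  have [[j bj]|ne] := pselect (exists j, b = e j).
    by exists (Some j); rewrite k0 bj.
  have {}ne i : b <> e i by move=> h; apply: ne; exists i.
  have [i pbi _] := pos_root_sub_simple pb ne.
  have [] := split2 _ _ (affpos_finite pbi) (affpos_finite (simple_pos i));
    rewrite wE k0.
  by congr pair; rewrite /= ?subrK ?addr0.
have k1 := int_gt0 ki k0.
have kE : k = 1.
  apply/eqP; rewrite eq_le k1 andbT leNgt; apply/negP => k2; case: h1.
  rewrite (_ : _ - _ = (b, k - 1)); last by congr pair; rewrite /= subr0.
  apply: lvl => //.
  - by right; rewrite subr_gt0.
  - by rewrite rpredB ?rpred1.
  - by move=> /eqP; rewrite subr_eq0 gt_eqF.
have [pb|/(pos_rootN Db) pb] := pselect (pos_root b).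
  case: h1; rewrite (_ : _ - _ = (b, 0)); first exact: affpos_finite.
  by congr pair; rewrite /= ?subr0 // kE subrr.
have [bth|/(pos_root_raise pb)[d pd pbd]] := pselect (- b = theta).
  by exists None; rewrite /= kE -bth opprK.
have [] := split2 (- (- b + d), 1%:R) (d, 0) _ (affpos_finite pd).
  by apply: affpos_level => //; apply/rs_opp/pos_is_root.
by rewrite wE kE; congr pair; rewrite /= ?addr0 // opprD opprK subrK.
Qed.

(** s_i permutes the positive affine roots other than alpha_i, so passing from
    w to s_i w only changes the sign of the image of delta - c. *)
Lemma minuscule_reflect c i : pos_root c -> w (c, -1) = affine_simple i ->
  forall p, affpos p -> affpos (- affine_reflection i (w p)) <->
    p.2 = 1 /\ J (- p.1) /\ - p.1 <> c.
Proof.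
move=> pc wc p ap; have [Dp pi _] := ap.
have wpE : - w p = affine_simple i -> - p.1 = c /\ p.2 = 1.
  by rewrite -affine_actN -wc => /affine_act_inj;
    case: (p) => x k [-> /oppr_inj].
rewrite -affine_reflectionN; split=> [a1|[p2 [Jp pc']]]; last first.
  by apply: affine_reflection_pos; [apply/wJ|move=> /wpE[]].
have [/wpE[xc p2]|nE] := pselect (- w p = affine_simple i).
  have pE : p = (- c, 1) by rewrite -xc opprK -p2; case: (p).
  have : - w p = affine_simple i.
    by rewrite -affine_actN pE -wc; congr affine_act; congr pair;
      rewrite /= opprK.
  move=> h; move: a1; rewrite h affine_reflection_simple => /affpos_oppF [];
    rewrite opprK.
  exact: affpos_simple.
have aw : affpos (- w p).
  rewrite -(affine_reflectionK i (- w p));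
    apply: affine_reflection_pos => // qE; case: (affpos_oppF ap).
  have : w p = w (c, -1).
    by rewrite wc -[w p]opprK -(affine_reflectionK i (- w p)) qE
      affine_reflection_simple opprK.
  move=> /affine_act_inj ->; split;
    [exact/rs_opp/pos_is_root|by rewrite /= rpredN rpredN1|].
  by left; rewrite /= opprK.
have [p2 Jp] := (wJ ap).1 aw; split=> //; split=> // xc; apply: nE.
rewrite -affine_actN -wc; congr affine_act; case: (p) p2 xc => x k /= -> <-.
by congr pair.
Qed.

End Minuscule.

(** y = v_2^-1 v_1 fixes theta.  It keeps positive the roots which pair
    positively with theta, because all roots doing so are positive; and those
    orthogonal to theta, because v_1 and v_2 keep them positive.  So y = 1. *)
Lemma minuscule_unique vs1 vs2 (J1 J2 : V -> Prop) :
  minuscule_for (affine_act vs1 (- dual_root theta)) J1 ->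
  minuscule_for (affine_act vs2 (- dual_root theta)) J2 ->
  rword vs1 theta = rword vs2 theta ->
  forall a, pos_root a -> J1 a <-> J2 a.
Proof.
move=> w1 w2 thE; pose y := rev vs2 ++ vs1.
have yth : rword y theta = theta by rewrite rword_cat thE rwordK.
have y_ip a : ip (rword y a) theta = ip a theta by rewrite -{1}yth rword_ip.
have stay vs (J : V -> Prop) :
    minuscule_for (affine_act vs (- dual_root theta)) J ->
    forall a, pos_root a -> ip a theta = 0 -> pos_root (rword vs a).
  move=> wJ a pa ha.
  have : affpos (affine_act vs (- dual_root theta) (a, 0)).
    apply: (minuscule_keep _ wJ) => //;
      first exact/colatticeN/colattice_dual_root/pos_is_root.
      exact: affpos_finite.
    by case=> /eqP; rewrite eq_sym oner_eq0.
  rewrite /affine_act /= ipNr ip_dual_root ha mulr0 oppr0 subr0.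
  by case=> _ _ [|[]//]; rewrite ltxx.
have yid : rword y =1 id.
  apply: rword_pos_id => a pa; have Dy := rword_root y (pos_is_root pa).
  have := theta_dominant pa; rewrite le_eqVlt => /orP[/eqP/esym a0|a0];
    last first.
    by apply: pos_root_of_ip => //; rewrite y_ip.
  apply: contrapT => /(pos_rootN Dy) py.
  have := stay _ _ w2 _ py; rewrite ipNl y_ip a0 oppr0 => /(_ erefl).
  rewrite rwordN rword_cat rwordVK => /pos_root_oppF; rewrite opprK; apply.
  exact: (stay _ _ w1).
have v12 a : rword vs1 a = rword vs2 a.
  by rewrite -[in RHS](yid a) rword_cat rwordVK.
move=> a pa; have ap := affpos_level (rs_opp (pos_is_root pa)) (ltn0Sn 0).
have [h1 h1'] := w1 _ ap; have [h2 h2'] := w2 _ ap.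
rewrite /affine_act /= opprK v12 in h1 h1';
  rewrite /affine_act /= opprK in h2 h2'.
by split=> Ja; [case: h2 => //; apply: h1'|case: h1 => //; apply: h2'].
Qed.

End Affine.
End RootSystem.

(** * Linear algebra *)

Lemma linear_hom (K : fieldType) (U W : vectType K) (f : U -> W) :
  linear f -> exists F : 'Hom(U, W), F =1 f.
Proof.
move=> lf; pose fL := HB.pack_for {linear U -> W} f
  (GRing.isLinear.Build _ _ _ _ f lf).
by exists (linfun fL) => x; rewrite lfunE.
Qed.

Lemma dual_free_surj (K : fieldType) (U : vectType K) n
    (F : n.-tuple 'Hom(U, K^o)) : free F ->
  forall c : 'I_n -> K, exists u, forall i : 'I_n, F`_i u = c i.
Proof.
move=> freeF c; pose B := vbasis {:U}.
pose M : 'M[K]_(n, \dim {:U}) := \matrix_(i, j) F`_i B`_j.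
have /row_freeP[M' MM'] : row_free M.
  apply: inj_row_free => v vM0; apply/rowP => i; rewrite mxE.
  move: freeF => /freeP/(_ (v 0)); apply; apply/lfunP => u.
  rewrite zero_lfunE (coord_vbasis (memvf u)) linear_sum big1 // => j _.
  rewrite linearZ /= sum_lfunE; have /rowP/(_ j) := vM0; rewrite !mxE => E.
  rewrite (_ : \sum_i _ = 0) ?scaler0 // -[RHS]E; apply: eq_bigr => k _.
  by rewrite scale_lfunE mxE.
exists (\sum_j (M' *m \col_k c k) j 0 *: B`_j) => i.
transitivity ((M *m (M' *m \col_k c k)) i 0);
  last by rewrite mulmxA MM' mul1mx mxE.
rewrite linear_sum mxE; apply: eq_bigr => j _.
by rewrite linearZ /= [M i j]mxE; apply: mulrC.
Qed.

Lemma mxtrace_commutator (K : comNzRingType) m (A B C : 'M[K]_m) :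
  \tr ((B *m A - A *m B) *m C) = \tr (A *m (C *m B - B *m C)).
Proof.
rewrite mulmxBl mulmxBr !raddfB /= !mulmxA; congr (_ - _).
by rewrite -(mulmxA B); apply: mxtrace_mulC.
Qed.

(** * Root spaces *)

Section Lie.
Variables (R : realType) (g : vectType R[i]) (br : g -> g -> g).
Hypothesis g_lie : lie_bracket br.
Variables (t : {vspace g}) (t_cartan : cartan_subalgebra br t).
Local Notation C := R[i].
Local Notation W := (@root_space R g br t).
Local Notation dual := (dual t).

Lemma brDr x y z : br x (y + z) = br x y + br x z.
Proof. by case: g_lie => /(_ x 1 y z); rewrite !scale1r. Qed.
Lemma br0r x : br x 0 = 0.
Proof. by apply/(addrI (br x 0)); rewrite -brDr !addr0. Qed.
Lemma brZr k x y : br x (k *: y) = k *: br x y.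
Proof. by case: g_lie => /(_ x k y 0); rewrite br0r !addr0. Qed.
Lemma brNr x y : br x (- y) = - br x y.
Proof. by rewrite -scaleN1r brZr scaleN1r. Qed.
Lemma brxx x : br x x = 0. Proof. by case: g_lie. Qed.
Lemma brDl x y z : br (x + y) z = br x z + br y z.
Proof. by case: g_lie => _ /(_ z 1 x y); rewrite !scale1r. Qed.
Lemma brC x y : br x y = - br y x.
Proof.
apply/eqP; rewrite -addr_eq0; have := brxx (x + y).
by rewrite !brDl !brDr !brxx add0r addr0 => /eqP.
Qed.
Lemma br0l x : br 0 x = 0. Proof. by rewrite brC br0r oppr0. Qed.
Lemma brZl k x y : br (k *: x) y = k *: br x y.
Proof. by rewrite brC brZr brC scalerN opprK. Qed.
Lemma br_sumr I (s : seq I) (P : pred I) (F : I -> g) x :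
  br x (\sum_(i <- s | P i) F i) = \sum_(i <- s | P i) br x (F i).
Proof. by elim/big_rec2: _ => [|i y1 y2 _ <-]; rewrite ?br0r ?brDr. Qed.

Lemma br_suml I (s : seq I) (P : pred I) (F : I -> g) x :
  br (\sum_(i <- s | P i) F i) x = \sum_(i <- s | P i) br (F i) x.
Proof. by elim/big_rec2: _ => [|i y1 y2 _ <-]; rewrite ?br0l ?brDl. Qed.

Lemma jacobi x y z : br x (br y z) = br (br x y) z + br y (br x z).
Proof.
case: g_lie => _ _ _ /(_ x y z) /eqP.
rewrite -addrA addr_eq0 => /eqP ->.
by rewrite (brC (br x y)) (brC x z) brNr opprD addrC.
Qed.

Lemma root_space0 a : W a 0. Proof. by move=> h; rewrite br0r scaler0. Qed.

Lemma root_spaceD a x y : W a x -> W a y -> W a (x + y).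
Proof. by move=> hx hy h; rewrite brDr hx hy scalerDr. Qed.

Lemma root_spaceZ a k x : W a x -> W a (k *: x).
Proof. by move=> hx h; rewrite brZr hx !scalerA mulrC. Qed.

Lemma root_spaceB a x y : W a x -> W a y -> W a (x - y).
Proof.
by move=> hx hy; apply: root_spaceD => //; rewrite -scaleN1r;
  apply: root_spaceZ.
Qed.

Lemma root_space_br (a b : dual) x y : W a x -> W b y -> W (a + b) (br x y).
Proof.
move=> hx hy h; rewrite jacobi hx hy brZl brZr add_lfunE scalerDl.
by congr (_ + _).
Qed.

Lemma zero_weight_t x : W (0 : dual) x -> x \in t.
Proof.
case: t_cartan => _ h _ hx; apply: h => k kt.
by have := hx (Subvs kt); rewrite zero_lfunE scale0r.
Qed.

Lemma t_br h k : h \in t -> k \in t -> br h k = 0.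
Proof. by case: t_cartan => + _ _ => /(_ h k). Qed.

Lemma t_zero_weight x : x \in t -> W (0 : dual) x.
Proof. by move=> xt h; rewrite zero_lfunE scale0r t_br ?subvsP. Qed.

Lemma eigen_weight x : x != 0 ->
  (forall h, h \in t -> exists c : C, br h x = c *: x) ->
  exists a : dual, W a x.
Proof.
move=> x0 hx.
have /choice[f hf] : forall h : subvs_of t, exists c : C,
  br (vsval h) x = c *: x.
  by move=> h; apply: hx; apply: subvsP.
have lf : linear (f : subvs_of t -> C^o).
  move=> k u v; apply/eqP; rewrite -subr_eq0; apply/eqP.
  have : (f (k *: u + v) - (k *: (f u : C^o) + f v)) *: x = 0.
    by rewrite scalerBl scalerDl -scalerA -!hf brDl brZl subrr.
  by move/eqP; rewrite scaler_eq0 (negbTE x0) orbF => /eqP.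
by have [F hF] := linear_hom lf; exists F => h; rewrite hF hf.
Qed.

Lemma eigenbasis : exists N (X : N.-tuple g) (xi : 'I_N -> dual),
  basis_of fullv X /\ forall i, W (xi i) X`_i.
Proof.
case: t_cartan => _ _ [X bX hX].
have h (i : 'I_(size X)) : exists a : dual, W a X`_i.
  have Xi : X`_i \in X by rewrite mem_nth.
  apply: eigen_weight; last by apply: hX.
  by apply: free_not0 Xi; apply: basis_free bX.
by have [xi hxi] := choice h; exists (size X), (in_tuple X), xi.
Qed.

Section Basis.
Variables (N : nat) (X : N.-tuple g) (xi : 'I_N -> dual).
Hypotheses (X_basis : basis_of fullv X) (X_wt : forall i, W (xi i) X`_i).

Lemma eigen_sum x : x = \sum_i coord X i x *: X`_i.
Proof. exact: coord_basis X_basis (memvf x). Qed.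

Lemma eigen_free : free X. Proof. exact: basis_free X_basis. Qed.

Lemma coord_br_t i (h : subvs_of t) x :
  coord X i (br (vsval h) x) = xi i h * coord X i x.
Proof.
rewrite {1}(eigen_sum x) br_sumr.
under eq_bigr => j _ do rewrite brZr X_wt scalerA.
by rewrite coord_sum_free ?eigen_free // mulrC.
Qed.

Lemma weight_coord a x i : W a x -> coord X i x != 0 -> xi i = a.
Proof.
move=> hx xi0; apply/lfunP => h; apply: (mulIf xi0).
by rewrite -coord_br_t hx linearZ.
Qed.

(** The projection of g onto the root space of a along the other ones, written
    in the eigenbasis X. *)
Definition wproj (a : dual) (x : g) : g :=
  \sum_(i | xi i == a) coord X i x *: X`_i.

Lemma wprojD a x y : wproj a (x + y) = wproj a x + wproj a y.
Proof.
by rewrite /wproj -big_split; apply: eq_bigr => i _; rewrite linearD scalerDl.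
Qed.

Lemma wprojZ a k x : wproj a (k *: x) = k *: wproj a x.
Proof.
by rewrite /wproj scaler_sumr; apply: eq_bigr => i _; rewrite linearZ scalerA.
Qed.

Lemma wproj0 a : wproj a 0 = 0.
Proof. by apply/(addrI (wproj a 0)); rewrite -wprojD !addr0. Qed.

Lemma wproj_big I (s : seq I) (P : pred I) (F : I -> g) a :
  wproj a (\sum_(i <- s | P i) F i) = \sum_(i <- s | P i) wproj a (F i).
Proof. by elim/big_rec2: _ => [|i y1 y2 _ <-]; rewrite ?wproj0 ?wprojD. Qed.

Lemma wproj_root_space a x : W a (wproj a x).
Proof.
rewrite /wproj; elim/big_ind: _ => [|x1 y1|i /eqP <-];
  [exact: root_space0|exact: root_spaceD|].
exact/root_spaceZ/X_wt.
Qed.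

Lemma wproj_id a x : W a x -> wproj a x = x.
Proof.
move=> hx; rewrite [in RHS](eigen_sum x) /wproj [in RHS](bigID (fun i => xi i
  == a)) /=.
rewrite [X in _ + X]big1 ?addr0 // => i; apply: contraNeq => h.
apply/eqP/(weight_coord hx); apply: contraNneq h => ->.
by rewrite scale0r.
Qed.

Lemma wproj_other a b x : W b x -> a != b -> wproj a x = 0.
Proof.
move=> hx ab; rewrite /wproj big1 // => i /eqP xia.
apply/eqP; rewrite scaler_eq0; apply/orP; left.
apply: contraNT ab => /(weight_coord hx) <-; exact/eqP.
Qed.

Lemma weight_codom a x : W a x -> x != 0 -> a \in codom xi.
Proof.
move=> /wproj_id <- ; apply: contraNT => h;
  rewrite /wproj big1 // => i /eqP xia.
by case/negP: h; rewrite -xia codom_f.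
Qed.

(** To isolate the other components from the one of weight a0, apply
    ad h - a0(h) for an h which separates the weight from a0. *)
Lemma weight_components (U : {vspace g}) (s : seq dual) (f : dual -> g) :
  (forall h x, h \in t -> x \in U -> br h x \in U) ->
  uniq s -> (forall a, a \in s -> W a (f a)) ->
  \sum_(a <- s) f a \in U -> forall a, a \in s -> f a \in U.
Proof.
move=> stab; elim: s f => // a0 s IH f /= /andP[a0s us] hf.
rewrite big_cons => sumU.
have IHs a : a \in s -> f a \in U.
  move=> as_; have ne : a != a0 by apply: contraNneq a0s => <-.
  have [h hh] : exists h, a h != a0 h.
    apply: contrapT => nh; case/eqP: ne; apply/lfunP => h.
    by apply/eqP/negPn/negP => hh; apply: nh; exists h.
  have dh0 : a h - a0 h != 0 by rewrite subr_eq0.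
  rewrite -[f a](scalerK dh0) memvZ //.
  apply: (IH (fun b => (b h - a0 h) *: f b)) => // [b bs|].
    by apply/root_spaceZ/hf; rewrite inE bs orbT.
  have -> : \sum_(b <- s) (b h - a0 h) *: f b =
      br (vsval h) (f a0 + \sum_(b <- s) f b) - a0 h *: (f a0 + \sum_(b <- s) f
        b).
    rewrite brDr hf ?mem_head // scalerDr opprD addrACA subrr add0r.
    rewrite br_sumr scaler_sumr -sumrB [in LHS]big_seq [in RHS]big_seq.
    apply: eq_bigr => b bs.
    by rewrite hf ?inE ?bs ?orbT // scalerBl.
  by rewrite memvB ?memvZ // stab // subvsP.
move=> a; rewrite inE => /orP[/eqP ->|/IHs//].
rewrite -(addrK (\sum_(b <- s) f b) (f a0)) memvB //.
by rewrite big_seq; apply: memv_suml.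
Qed.

Lemma wproj_sum x : x = \sum_(a <- undup (codom xi)) wproj a x.
Proof.
rewrite [LHS](eigen_sum x) /wproj (exchange_big_dep xpredT) //=;
  apply: eq_bigr => i _.
rewrite big_mkcond (bigD1_seq (xi i)) ?undup_uniq ?mem_undup ?codom_f //= eqxx.
by rewrite big1 ?addr0 // => a /negbTE; rewrite eq_sym => ->.
Qed.

(** * The Killing form *)

Definition ad_mx (x : g) : 'M[C]_N := \matrix_(i, j) coord X j (br x X`_i).
Definition killing (x y : g) : C := \tr (ad_mx x *m ad_mx y).

Lemma ad_mx_mul x y : ad_mx x *m ad_mx y = \matrix_(i,
  j) coord X j (br y (br x X`_i)).
Proof.
apply/matrixP => i j; rewrite !mxE {1}(eigen_sum (br x X`_i)) br_sumr
  linear_sum.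
by apply: eq_bigr => k _; rewrite !mxE brZr linearZ.
Qed.

Lemma ad_mx_br x y : ad_mx (br x y) = ad_mx y *m ad_mx x - ad_mx x *m ad_mx y.
Proof.
rewrite !ad_mx_mul; apply/matrixP => i j; rewrite !mxE (jacobi x).
by rewrite linearD addrK.
Qed.

Lemma ad_mxD x y : ad_mx (x + y) = ad_mx x + ad_mx y.
Proof. by apply/matrixP => i j; rewrite !mxE brDl linearD. Qed.

Lemma ad_mxZ k x : ad_mx (k *: x) = k *: ad_mx x.
Proof. by apply/matrixP => i j; rewrite !mxE brZl linearZ. Qed.

Lemma killingC x y : killing x y = killing y x. Proof. exact: mxtrace_mulC. Qed.

Lemma killingDr x y z : killing x (y + z) = killing x y + killing x z.
Proof. by rewrite /killing ad_mxD mulmxDr mxtraceD. Qed.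

Lemma killingZr k x y : killing x (k *: y) = k * killing x y.
Proof. by rewrite /killing ad_mxZ -scalemxAr mxtraceZ. Qed.

Lemma killingDl x y z : killing (x + y) z = killing x z + killing y z.
Proof. by rewrite !(killingC _ z) killingDr. Qed.

Lemma killingZl k x y : killing (k *: x) y = k * killing x y.
Proof. by rewrite !(killingC _ y) killingZr. Qed.

Lemma killing0r x : killing x 0 = 0.
Proof. by apply/(addrI (killing x 0)); rewrite -killingDr !addr0. Qed.

Lemma killing_invariant x y z : killing (br x y) z = killing x (br y z).
Proof.
by rewrite /killing !ad_mx_br mxtrace_commutator.
Qed.

Lemma killing_sumr I (s : seq I) (P : pred I) (F : I -> g) x :
  killing x (\sum_(i <- s | P i) F i) = \sum_(i <- s | P i) killing x (F i).
Proof.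
by elim/big_rec2: _ => [|i y1 y2 _ <-]; rewrite ?killing0r ?killingDr.
Qed.

Lemma killing_weight (a b : dual) x y : W a x -> W b y ->
  killing x y != 0 -> b = - a.
Proof.
move=> hx hy k0; apply/lfunP => h; rewrite opp_lfunE.
suff E : (b h : C) * killing x y = - a h * killing x y by exact: mulIf k0 _ _ E.
have := killing_invariant x (vsval h) y;
  rewrite brC hx hy -scaleN1r scalerA mulN1r.
by rewrite killingZl killingZr => <-.
Qed.

Lemma killing_t (h : subvs_of t) :
  killing (vsval h) (vsval h) = \sum_i xi i h ^+ 2.
Proof.
rewrite /killing ad_mx_mul; apply: eq_bigr => i _; rewrite mxE !coord_br_t.
by rewrite coord_free ?eigen_free // eqxx mulr1 expr2.
Qed.

(** * Strings of root spaces *)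

(** The case c = 2 is that of an sl2-triple; c = 0 is used to show that the
    bracket of dual root vectors is not killed by their root. *)
Lemma raise_lower e f h v (c l : C) k :
  br e f = h -> br h f = - c *: f -> br e v = 0 -> br h v = l *: v ->
  br h (iter k (br f) v) = (l - k%:R * c) *: iter k (br f) v /\
  br e (iter k.+1 (br f) v) = (k.+1%:R * (l - k%:R * c / 2)) *: iter k (br f) v.
Proof.
move=> ef hf ev hv.
have hk j : br h (iter j (br f) v) = (l - j%:R * c) *: iter j (br f) v.
  elim: j => [|j IH] /=; first by rewrite mul0r subr0.
  rewrite jacobi hf IH brZl brZr -scalerDl -natr1; congr (_ *: _); ring.
split; first exact: hk.
elim: k => [|k IH].
  by rewrite /= jacobi ef ev br0r addr0 hv; congr (_ *: _); field.
rewrite iterS jacobi ef IH hk brZr -iterS -scalerDl; congr (_ *: _).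
by rewrite -!natr1; field.
Qed.

Lemma root_space_iter (a b : dual) f v k : W a f -> W b v ->
  W (b + a *+ k) (iter k (br f) v).
Proof.
move=> hf hv; elim: k => [|k IH]; first by rewrite mulr0n addr0.
by rewrite iterS mulrS addrCA; apply: root_space_br.
Qed.

(** The nonzero vectors f^k v have distinct weights, of which there are finitely
    many. *)
Lemma root_vector_nilpotent (a b : dual) f v : a != 0 -> W a f -> W b v ->
  v != 0 ->
  exists k, iter k (br f) v != 0 /\ iter k.+1 (br f) v = 0.
Proof.
move=> a0 hf hv v0.
have hk : exists k, iter k (br f) v == 0.
  apply: contrapT => nk.
  have nz k : iter k (br f) v != 0 by apply/negP => hk; apply: nk; exists k.
  have : (size (map (fun k => (b + a *+ k)%R) (iota 0 N.+1)) <= size (codom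
    xi))%N.
    apply: uniq_leq_size => [|c /mapP[k _ ->]].
      rewrite map_inj_uniq ?iota_uniq // => k l /addrI/eqP.
      rewrite -subr_eq0 -(scaler_nat k) -(scaler_nat l) -scalerBl scaler_eq0
        (negbTE a0) orbF.
      by rewrite subr_eq0 eqr_nat => /eqP.
    exact: weight_codom (root_space_iter k hf hv) (nz k).
  by rewrite size_map size_iota size_codom card_ord ltnn.
case: (ex_minnP hk) => -[|m] /eqP hm mmin.
  by rewrite (hm : v = 0) eqxx in v0.
exists m; split=> //; apply/negP => /mmin; by rewrite ltnn.
Qed.

Hypothesis g_simple : simple_lie br.
Variables (n : nat) (Pi : n.-tuple dual).
Hypothesis Pi_simple : simple_roots br Pi.

Lemma weight_root a x : W a x -> x != 0 -> a != 0 -> lie_root br a.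
Proof. by move=> hx x0 a0; split=> //; exists x. Qed.

Lemma xi_root i : xi i != 0 -> lie_root br (xi i).
Proof.
apply: weight_root (X_wt i) _; apply: (free_not0 eigen_free).
by rewrite mem_nth ?size_tuple.
Qed.

(** Take h with value 1 on all simple roots: the weights take integral values at
    h which vanish only for the weight 0, and killing h h is the sum of their
    squares.  If it vanished, t would be all of g and g would be abelian. *)
Lemma killing_neq0 : exists h : subvs_of t, killing (vsval h) (vsval h) != 0.
Proof.
case: Pi_simple => Pi_free _ Pi_base.
have [h hPi] := dual_free_surj Pi_free (fun=> 1 : C).
exists h; rewrite killing_t; apply/eqP => sum0.
have ht i : exists2 k : nat, xi i h ^+ 2 = k%:R :> C & (k = 0)%N -> xi i = 0.
  have [->|x0] := eqVneq (xi i) 0; first by exists 0%N => //;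
    rewrite zero_lfunE expr0n.
  have [m hm] := Pi_base _ (xi_root x0); set s := (\sum_j m j)%N.
  have sE : (\sum_j (m j)%:R *: Pi`_j : dual) h = s%:R :> C.
    rewrite sum_lfunE natr_sum; apply: eq_bigr => j _.
    by rewrite scale_lfunE hPi; exact: mulr1.
  exists (s ^ 2)%N; first by case: hm => ->; rewrite ?opp_lfunE ?sqrrN sE natrX.
  move=> /eqP; rewrite expn_eq0 /= andbT sum_nat_eq0 => /forallP s0.
  have S0 : \sum_j (m j)%:R *: Pi`_j = 0 :> dual.
    by apply: big1 => j _; rewrite (eqP (s0 j)) scale0r.
  by case: hm => ->; rewrite S0 ?oppr0.
have {}ht i : xi i = 0.
  have [k hk k0] := ht i; apply: k0.
  have /psumr_eq0P : forall j : 'I_N, true -> 0 <= xi j h ^+ 2 :> C.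
    by move=> j _; have [l -> _] := ht j; apply: ler0n.
  by move=> /(_ sum0 i isT); rewrite hk => /eqP; rewrite pnatr_eq0 => /eqP.
have all_t x : x \in t.
  rewrite (eigen_sum x); apply: memv_suml => i _; apply: memvZ.
  by apply: zero_weight_t; rewrite -(ht i).
by case: g_simple => -[x [y /eqP xy]] _; case: xy; apply: t_br; apply: all_t.
Qed.

(** The radical is an ideal and is not g. *)
Lemma killing_nondeg x : (forall y, killing x y = 0) -> x = 0.
Proof.
have lK : linear (fun x => \sum_(i < N) killing x X`_i *: X`_i).
  move=> k u v; rewrite scaler_sumr -big_split; apply: eq_bigr => i _.
  by rewrite killingDl killingZl scalerDl scalerA.
have [K hK] := linear_hom lK.
have kerP u : reflect (forall y, killing u y = 0) (u \in lker K).
  rewrite memv_ker hK; apply: (iffP eqP) => h; last first.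
    by rewrite big1 // => i _; rewrite h scale0r.
  move=> y; rewrite (eigen_sum y) killing_sumr big1 // => i _;
    rewrite killingZr.
  have := congr1 (coord X i) h;
    rewrite coord_sum_free ?eigen_free // linear0 => ->.
  by rewrite mulr0.
case: g_simple => _ /(_ (lker K))[].
- move=> u v /kerP hv; apply/kerP => y.
  by rewrite brC -[- _]scaleN1r killingZl killing_invariant hv mulr0.
- by move=> k0 /kerP; rewrite k0 memv0 => /eqP.
move=> kf; have [h] := killing_neq0.
by have := memvf (vsval h); rewrite -kf => /kerP ->; rewrite eqxx.
Qed.

Lemma killing_dual a x : W a x -> x != 0 ->
  exists2 y, W (- a) y & killing x y != 0.
Proof.
move=> hx x0; apply: contrapT => h; case/eqP: x0; apply: killing_nondeg => y.
rewrite (eigen_sum y) killing_sumr big1 // => i _; rewrite killingZr.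
have [->|k0] := eqVneq (killing x X`_i) 0; first by rewrite mulr0.
by case: h; exists X`_i => //; rewrite -(killing_weight hx (X_wt i) k0).
Qed.

Lemma br_opp_t a x y : W a x -> W (- a) y -> br x y \in t.
Proof.
by move=> hx hy; apply: zero_weight_t; rewrite -(subrr a); apply: root_space_br.
Qed.

Lemma killing_br_t (a : dual) x y (h : subvs_of t) : W a x ->
  killing (vsval h) (br x y) = a h * killing x y.
Proof. by move=> hx; rewrite -killing_invariant hx killingZl. Qed.

Definition sl2_triple (a : dual) e f (h : subvs_of t) :=
  [/\ a != 0, W a e, W (- a) f, vsval h = br e f & a h = 2].

Lemma sl2_opp a e f h : sl2_triple a e f h -> sl2_triple (- a) f e (- h).
Proof.
case=> a0 ae af hE ah; split; rewrite ?oppr_eq0 ?opprK //.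
  by rewrite linearN /= hE -brC.
by rewrite opp_lfunE linearN opprK.
Qed.

(** At the last k with f^k v nonzero, raise_lower gives
    0 = (k + 1) (b(h) - k a(h) / 2) f^k v. *)
Lemma top_weight (a b : dual) e f (h : subvs_of t) v : a != 0 ->
  W (- a) f -> vsval h = br e f ->
  W b v -> v != 0 -> br e v = 0 -> exists k : nat, b h = k%:R * a h / 2.
Proof.
move=> a0 hf hE hv v0 ev; have na0 : - a != 0 by rewrite oppr_eq0.
have [k [k0 k1]] := root_vector_nilpotent na0 hf hv v0; exists k.
have hhf : br (vsval h) f = - (a h : C) *: f by rewrite hf opp_lfunE.
have [_] := raise_lower k (esym hE) hhf ev (hv h); rewrite k1 br0r.
move/esym/eqP; rewrite scaler_eq0 (negbTE k0) orbF mulf_eq0 pnatr_eq0 /=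
  subr_eq0.
by move/eqP.
Qed.

Lemma top_vector (a b : dual) e v : a != 0 -> W a e -> W b v -> v != 0 ->
  exists k u, [/\ W (b + a *+ k) u, u != 0 & br e u = 0].
Proof.
move=> a0 he hv v0; have [k [k0 k1]] := root_vector_nilpotent a0 he hv v0.
by exists k, (iter k (br e) v); split=> //; apply: root_space_iter.
Qed.

(** Let y be dual to e for the Killing form and h = [e, y].  If a(h) = 0, then
    b(h) = 0 for every weight b, by top_weight at the top of the a-string
    through b; so ad h = 0, whereas killing h h' = a(h') killing e y. *)
Lemma sl2_exists a e : W a e -> e != 0 -> a != 0 ->
  exists f h, sl2_triple a e f h /\ killing e f != 0.
Proof.
move=> he e0 a0; have [y hy ky] := killing_dual he e0.
have ht := br_opp_t he hy; pose h := Subvs ht.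
have ah0 : a h != 0.
  apply/eqP => ah.
  have bh (b : dual) x : W b x -> x != 0 -> b h = 0.
    move=> hx x0; have [k [u [hu u0 eu]]] := top_vector a0 he hx x0.
    have [m] := top_weight a0 hy (erefl : vsval h = br e y) hu u0 eu.
    by rewrite add_lfunE -scaler_nat scale_lfunE ah mulr0 mul0r scaler0 addr0.
  have [h' ah'] : exists h', a h' != 0.
    apply: contrapT => nh; case/eqP: a0; apply/lfunP => h'; rewrite zero_lfunE.
    by apply/eqP/negPn/negP => ?; apply: nh; exists h'.
  have := killing_br_t y h' he; rewrite /killing ad_mx_mul /mxtrace big1.
    by move/esym/eqP; rewrite mulf_eq0 (negbTE ah') (negbTE ky).
  move=> i _; rewrite mxE -[br e y]/(vsval h) coord_br_t.
  by rewrite (bh _ _ (X_wt i)) ?mul0r // (free_not0 eigen_free) // mem_nth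
    ?size_tuple.
exists ((2 / a h) *: y), ((2 / a h) *: h); split; last first.
  by rewrite killingZr mulf_neq0 // mulf_neq0 ?invr_neq0 // pnatr_eq0.
split=> //; first exact: root_spaceZ.
  by rewrite linearZ brZr.
by rewrite linearZ; apply: (divfK ah0).
Qed.

Lemma sl2_top_weight a b e f h v : sl2_triple a e f h -> W b v -> v != 0 ->
  br e v = 0 ->
  exists k : nat, b h = k%:R.
Proof.
move=> [a0 _ hf hE ah] hv v0 ev.
have [k ->] := top_weight a0 hf hE hv v0 ev; exists k; rewrite ah mulfK //.
by rewrite pnatr_eq0.
Qed.

Lemma sl2_int a b e f h v : sl2_triple a e f h -> W b v -> v != 0 ->
  exists m : int, b h = m%:~R.
Proof.
move=> s hv v0; have [a0 he _ _ ah] := s.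
have [k [u [hu u0 eu]]] := top_vector a0 he hv v0.
have [m hm] := sl2_top_weight s hu u0 eu; exists (m%:Z - 2 * k%:Z).
rewrite rmorphB rmorphM /= -!pmulrn -hm add_lfunE -scaler_nat scale_lfunE ah.
by rewrite -[k%:R *: _]/(k%:R * 2) [_ * 2]mulrC addrK.
Qed.

(** Up to exchanging e and f, b(h) = m is a natural number.  If u is at the top
    of the string through v, q steps above it, then f^j u is nonzero for
    j <= m + 2 q, and j = m + q reaches the weight b - m a. *)
Lemma sl2_refl a b e f h v : sl2_triple a e f h -> W b v -> v != 0 ->
  exists2 u, W (b - b h *: a) u & u != 0.
Proof.
wlog [m bm] : a e f h / exists m : nat, b h = m%:R.
  move=> H s hv v0; have [m bh] := sl2_int s hv v0.
  case: m bh => m bh; first by apply: H s hv v0; exists m.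
  have [|u hu u0] := H (- a) f e (- h) _ (sl2_opp s) hv v0.
    by exists m.+1; rewrite linearN /= bh NegzE rmorphN opprK.
  have bN : b (- h) = - (b h : C) by exact: linearN.
  by exists u => //; move: hu; rewrite bN scalerN scaleNr opprK.
move=> s hv v0; have [a0 he hf hE ah] := s.
have [q [u [hu u0 eu]]] := top_vector a0 he hv v0.
have hhf : br (vsval h) f = - (2 : C) *: f by rewrite hf opp_lfunE ah.
have uh : (b + a *+ q) h = (m + 2 * q)%:R.
  by rewrite add_lfunE -scaler_nat scale_lfunE bm ah natrD natrM [2%:R *
    _]mulrC.
have nz j : (j <= m + 2 * q)%N -> iter j (br f) u != 0.
  elim: j => // j IH jm; apply/eqP => j0.
  have [_] := raise_lower j (esym hE) hhf eu (hu h); rewrite j0 br0r uh.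
  move/esym/eqP; rewrite scaler_eq0 (negbTE (IH (ltnW jm))) orbF.
  rewrite mulf_eq0 pnatr_eq0 /= mulfK ?pnatr_eq0 // -natrB 1?ltnW // pnatr_eq0.
  by rewrite subn_eq0 leqNgt jm.
exists (iter (m + q) (br f) u); last by apply: nz; lia.
have := root_space_iter (m + q) hf hu.
by rewrite bm scaler_nat mulNrn mulrnDr opprD addrACA -addrA subrr addr0 addrC.
Qed.

(** Subtract from x the multiple of e with the same Killing product with f.  The
    difference is killed by f, and has weight 2 for h; but a vector killed by f
    has a nonpositive weight. *)
Lemma root_space_line a e f h x : sl2_triple a e f h -> killing e f != 0 ->
  W a x -> exists c, x = c *: e.
Proof.
move=> s kef hx; have [a0 he hf hE ah] := s.
exists (killing x f / killing e f); apply/eqP; rewrite -subr_eq0;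
  apply/negPn/negP => x0.
move: x0; set y := x - _ => y0.
have hy : W a y by apply: root_spaceB => //; apply: root_spaceZ.
have kyf : killing y f = 0.
  by rewrite /y killingDl -scaleNr killingZl mulNr divfK // subrr.
have yf0 : br y f = 0.
  apply/eqP/negPn/negP => nz; have ht := br_opp_t hy hf.
  have [z hz] := killing_dual (t_zero_weight ht) nz; rewrite oppr0 in hz.
  have := killing_br_t f (Subvs (zero_weight_t hz)) hy.
  by rewrite kyf mulr0 /= killingC => ->; rewrite eqxx.
have fy : br f y = 0 by rewrite brC yf0 oppr0.
have [k] := sl2_top_weight (sl2_opp s) hy y0 fy.
rewrite linearN /= ah => /eqP; rewrite eq_sym -subr_eq0 opprK -natrD pnatr_eq0.
by rewrite addn_eq0 andbF.
Qed.

(** Let x have weight 2 a.  Here 3 a is no root, as it would have Cartan integer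
    2 / 3 with a, so e x = 0; and f x is a multiple of e, so e f x = 0.  But
    e f x - f e x = h x = 4 x. *)
Lemma double_root (a : dual) : lie_root br a -> ~ lie_root br (a *+ 2).
Proof.
move=> [a0 [e e0 he]] [b0 [x x0 hx]].
have [f [h [s kef]]] := sl2_exists he e0 a0; have [_ _ hf hE ah] := s.
have ex0 : br e x = 0.
  apply/eqP/negPn/negP => y0; have hy : W (a *+ 3) (br e x).
    by rewrite mulrS; apply: root_space_br.
  have a30 : a *+ 3 != 0 by rewrite -scaler_nat scaler_eq0 pnatr_eq0.
  have [f' [h' [s' _]]] := sl2_exists hy y0 a30; have [_ _ _ _] := s'.
  rewrite -scaler_nat scale_lfunE; have [m ->] := sl2_int s' he e0.
  rewrite -[_ *: _]/(3%:R * m%:~R) => /eqP.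
  rewrite -[3%:R]/(3%:Z%:~R) -[2]/(2%:Z%:~R) -rmorphM /= eqr_int; lia.
have hfx : W a (br f x).
  by have := root_space_br hf hx; rewrite mulr2n addKr.
have [c fx] := root_space_line s kef hfx.
have := jacobi e f x; rewrite fx brZr brxx scaler0 ex0 br0r addr0 -hE hx.
move/esym/eqP; rewrite scaler_eq0 (negbTE x0) orbF -scaler_nat scale_lfunE ah.
by rewrite -[_ *: _]/(2%:R * 2) mulf_eq0 orbb pnatr_eq0.
Qed.

(** * The roots form a root system *)

Variables (ip : 'rV[R]_n -> 'rV[R]_n -> R).
Hypotheses (ip_inner : inner_product ip) (ip_weyl : weyl_invariant br Pi ip).
Local Notation V := 'rV[R]_n.
Local Notation wt := (@weight_of R g t n Pi).
Local Notation D := (@Delta R g br t n Pi).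
Local Notation dual_root := (dual_root ip).
Local Open Scope complex_scope.

Lemma weight_ofD x y : wt (x + y) = wt x + wt y.
Proof.
rewrite /weight_of -big_split; apply: eq_bigr => i _.
by rewrite mxE rmorphD scalerDl.
Qed.

Lemma weight_ofZ (k : R) x : wt (k *: x) = k%:C *: wt x.
Proof.
rewrite /weight_of scaler_sumr; apply: eq_bigr => i _.
by rewrite mxE rmorphM scalerA.
Qed.

Lemma weight_ofN x : wt (- x) = - wt x.
Proof. by rewrite -scaleN1r weight_ofZ rmorphN rmorph1 scaleN1r. Qed.

Lemma weight_of0 : wt 0 = 0.
Proof. by apply/(addrI (wt 0)); rewrite -weight_ofD !addr0. Qed.

Lemma weight_of_nat (m : 'I_n ->
  nat) : wt (\row_i (m i)%:R) = \sum_i (m i)%:R *: Pi`_i.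
Proof. by apply: eq_bigr => i _; rewrite mxE rmorph_nat. Qed.

Lemma weight_of_eq0 x : wt x = 0 -> x = 0.
Proof.
case: Pi_simple => /freeP Pi_free _ _ x0; apply/rowP => i.
by have := Pi_free _ x0 i; rewrite mxE => /(congr1 (@complex.Re R)).
Qed.

Lemma weight_of_inj : injective wt.
Proof.
by move=> x y xy; apply/subr0_eq/weight_of_eq0;
  rewrite weight_ofD weight_ofN xy subrr.
Qed.

Lemma weight_of_simple i : wt (delta_mx 0 i) = Pi`_i.
Proof.
rewrite /weight_of (bigD1 i) //= mxE !eqxx rmorph1 scale1r big1 ?addr0 // => j
  ji.
by rewrite mxE (negbTE ji) andbF rmorph0 scale0r.
Qed.

Lemma root_coord a : lie_root br a ->
  exists2 x, wt x = a & root_le 0 x \/ root_le 0 (- x).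
Proof.
case: Pi_simple => _ _ Pi_base /Pi_base[m []] ->.
  exists (\row_i (m i)%:R); first exact: weight_of_nat.
  by left; exists m => i; rewrite !mxE subr0.
exists (- \row_i (m i)%:R); first by rewrite weight_ofN weight_of_nat.
by right; exists m => i; rewrite opprK !mxE subr0.
Qed.

Lemma root_vector a : D a -> exists2 x, x != 0 & W (wt a) x.
Proof. by case. Qed.

Lemma root_neq0 a : D a -> a != 0.
Proof. by case=> a0 _; apply: contraNneq a0 => ->; rewrite weight_of0. Qed.

Lemma root_sl2 a x : D a -> W (wt a) x -> x != 0 ->
  exists f h, sl2_triple (wt a) x f h /\ killing x f != 0.
Proof. by case=> a0 _ hx x0; apply: sl2_exists. Qed.

(** The reflection x - x(h) a is an isometry of ip which maps a to - a, and the
    product of y with a expresses y(h). *)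
Lemma weight_of_coroot a e f h : D a -> sl2_triple (wt a) e f h ->
  forall y, wt y h = (ip y (dual_root a))%:C.
Proof.
move=> Da s; have [_ he hf hE ah] := s.
have /choice[m hm] (i : 'I_n) : exists m : int, (Pi`_i : dual) h = m%:~R :> C.
  case: Pi_simple => _ /(_ i)[_ [x x0 hx]] _; exact: sl2_int s hx x0.
pose rho (y : V) : R := \sum_i y 0 i * (m i)%:~R.
have rhoE y : wt y h = (rho y)%:C.
  rewrite /weight_of sum_lfunE rmorph_sum; apply: eq_bigr => i _.
  by rewrite scale_lfunE hm rmorphM rmorph_int.
have rho_a : rho a = 2.
  by apply: complexI; rewrite -rhoE ah rmorph_nat.
have coh : lie_coroot br (wt a) h.
  by split=> //; exists e, f.
move=> y; rewrite rhoE; apply: (congr1 (@real_complex R)).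
have refl x : wt (x - rho x *: a) = wt x - wt x h *: wt a.
  by rewrite weight_ofD weight_ofN weight_ofZ -rhoE.
have := ip_weyl Da coh (refl y) (refl a); rewrite rho_a.
have -> : a - 2 *: a = - a.
  by rewrite -[X in X - _]scale1r -scalerBl -scaleN1r; congr (_ *: _); ring.
rewrite (ipNr ip_inner) (ipBl ip_inner) (ipZl ip_inner) (ip_dual_root ip_inner).
have := ip_gt0 ip_inner (root_neq0 Da) => aa h0.
rewrite [LHS](_ : _ = rho y * ip a a / ip a a); last by rewrite mulfK ?gt_eqF.
rewrite (_ : rho y * ip a a = 2 * ip y a); first by rewrite mulrAC.
by move: h0; lra.
Qed.

Lemma Delta_root_system : root_system ip D.
Proof.
split.
- exact: root_neq0.
- by move=> a /root_coord[x /weight_of_inj ->].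
- by move=> i; rewrite /Delta /= weight_of_simple; case: Pi_simple.
- move=> a b Da Db; have [x x0 hx] := root_vector Da.
  have [f [h [s _]]] := root_sl2 Da hx x0.
  have [y y0 hy] := root_vector Db; have [m hm] := sl2_int s hy y0.
  apply/intrP; exists m; apply: complexI.
  by rewrite -(weight_of_coroot Da s) hm rmorph_int.
- move=> a b Da Db; have [x x0 hx] := root_vector Da.
  have [f [h [s _]]] := root_sl2 Da hx x0.
  have [y y0 hy] := root_vector Db; have [u hu u0] := sl2_refl s hy y0.
  move: hu; rewrite (weight_of_coroot Da s) -weight_ofZ -weight_ofN -weight_ofD
    => hu.
  apply: (weight_root hu u0); apply/eqP => /weight_of_eq0 r0.
  have a0 := root_neq0 Da; have b0 := root_neq0 Db.
  case/eqP: b0; rewrite -(reflectionK ip_inner b a0) /reflection r0.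
  by rewrite ip0l // scale0r subr0.
- by move=> a Da; rewrite /Delta /= mulr2n weight_ofD -mulr2n;
  apply: double_root.
Qed.

Let rsD := Delta_root_system.

Lemma root_line a x y : D a -> W (wt a) x -> x != 0 -> W (wt a) y ->
  exists k, y = k *: x.
Proof.
move=> Da hx x0 hy; have [f [h [s kf]]] := root_sl2 Da hx x0.
exact: root_space_line s kf hy.
Qed.

(** If [x, y] = 0, then y is a top vector of an sl2-triple through x, and its
    weight, a positive multiple of (a, b), is nonnegative. *)
Lemma br_acute a b x y : D a -> W (wt a) x -> x != 0 ->
  W (wt b) y -> y != 0 -> ip a b < 0 -> br x y != 0.
Proof.
move=> Da hx x0 hy y0 ab; have [f [h [s _]]] := root_sl2 Da hx x0.
apply/eqP => xy0; have [k] := sl2_top_weight s hy y0 xy0.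
rewrite (weight_of_coroot Da s) -(rmorph_nat (real_complex R)) => /complexI k0.
have := ler0n R k; rewrite -k0 leNgt => /negP; apply.
rewrite ip_dual_root // ipC // pmulr_rlt0 // divr_gt0 //.
exact: ip_gt0 (root_neq0 Da).
Qed.

(** By invariance the trilinear form killing [x, y] z is alternating, so it is
    enough that [y, z] is not zero. *)
Lemma br_third a b c x y : D a -> W (wt a) x -> x != 0 ->
  D b -> W (wt b) y -> y != 0 -> D c -> a + b + c = 0 -> ip b c < 0 ->
  br x y != 0.
Proof.
move=> Da hx x0 Db hy y0 Dc abc bc; have [z z0 hz] := root_vector Dc.
have yz0 := br_acute Db hy y0 hz z0 bc.
have hyz : W (- wt a) (br y z).
  rewrite -weight_ofN (_ : - a = b + c) ?weight_ofD; first exact: root_space_br.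
  by apply/eqP; rewrite eq_sym -subr_eq0 opprK addrC addrA abc.
have [x' hx'] := killing_dual hyz yz0; rewrite opprK in hx'.
have [k ->] := root_line Da hx x0 hx'; rewrite killingZr mulf_eq0 negb_or.
case/andP=> _; apply: contraNneq => xy0.
by rewrite killingC -killing_invariant xy0 killingC killing0r.
Qed.

(** With c = - (a + b), the sum of (a, c) and (b, c) is - (c, c) < 0, so one of
    br_acute and br_third applies. *)
Lemma br_root_neq0 a b x y : D a -> W (wt a) x -> x != 0 ->
  D b -> W (wt b) y -> y != 0 -> D (a + b) -> br x y != 0.
Proof.
move=> Da hx x0 Db hy y0 Dab; pose c := - (a + b).
have Dc : D c by apply: rs_opp ip_inner _ rsD _ Dab.
have abc : a + b + c = 0 by rewrite subrr.
have [ab|ab] := ltP (ip a b) 0; first exact: br_acute hx x0 hy y0 ab.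
have [bc|bc] := ltP (ip b c) 0; first exact: br_third Dc abc bc.
have [ac|ac] := ltP (ip a c) 0.
  rewrite brC oppr_eq0; apply: (br_third Db hy y0 Da hx x0 Dc _ ac).
  by rewrite (addrC b).
have := ip_gt0 ip_inner (root_neq0 Dc).
rewrite {1}/c (ipNl ip_inner) (ipDl ip_inner); lra.
Qed.

(** * Roots of abelian ideals *)

Section Ideal.
Variables (I : {vspace g}) (I_ideal : abelian_ideal br Pi I).
Local Notation J := (ideal_roots br Pi I).

Lemma ideal_t h x : h \in t -> x \in I -> br h x \in I.
Proof.
case: I_ideal => _ stab _ ht; apply: stab; exists h, 0; split=> //.
  by exists [::]; rewrite // big_nil.
by rewrite addr0.
Qed.

Lemma ideal_pos c y x : Delta_pos br Pi c -> W (wt c) y -> x \in I ->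
  br y x \in I.
Proof.
case: I_ideal => _ stab _ pc hy; apply: stab; exists 0, y; split.
- exact: mem0v.
- exists [:: y]; last by rewrite big_seq1.
  by move=> z; rewrite inE => /eqP ->; exists c.
- by rewrite add0r.
Qed.

Lemma wproj_notin a x : a \notin codom xi -> wproj a x = 0.
Proof.
by move=> ha; apply: contraNeq ha => h; apply: weight_codom h;
  apply: wproj_root_space.
Qed.

Lemma ideal_wproj a x : x \in I -> wproj a x \in I.
Proof.
move=> xI; have [ha|/wproj_notin ->] := boolP (a \in codom xi);
  last exact: mem0v.
apply: (weight_components ideal_t (undup_uniq (codom xi)) (f := wproj^~ x)).
- by move=> b _; apply: wproj_root_space.
- by rewrite -wproj_sum.
- by rewrite mem_undup.
Qed.

(** Root spaces being lines, one nonzero vector of I brings in all of them. *)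
Lemma root_in_ideal c x : D c -> root_le 0 c -> W (wt c) x -> x != 0 ->
  x \in I -> J c.
Proof.
move=> Dc pc hx x0 xI; split=> // y hy.
by have [k ->] := root_line Dc hx x0 hy; apply: memvZ.
Qed.

Lemma ideal_support a x : x \in I -> wproj a x != 0 ->
  exists2 c, a = wt c & J c.
Proof.
move=> xI px; case: I_ideal => /(_ x xI)[s hs xE] _ _.
have [y ys py] : exists2 y, y \in s & wproj a y != 0.
  apply: contrapT => h; case/eqP: px;
    rewrite xE wproj_big big_seq big1 // => y ys.
  by apply/eqP/negPn/negP => py; apply: h; exists y.
have [c [Dc pc] hc] := hs y ys.
have ac : a = wt c by apply/eqP; apply: contraNT py => /(wproj_other hc) ->.
exists c => //; apply: (root_in_ideal Dc pc _ px); last exact: ideal_wproj.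
by rewrite -ac; apply: wproj_root_space.
Qed.

Lemma ideal_up c b : J c -> Delta_pos br Pi b -> Delta_pos br Pi (c + b) ->
  J (c + b).
Proof.
move=> [[Dc pc] hc] pb [Dcb pcb]; have [Db _] := pb.
have [x x0 hx] := root_vector Dc; have [y y0 hy] := root_vector Db.
have h : W (wt (c + b)) (br y x) by rewrite addrC weight_ofD;
  apply: root_space_br.
apply: (root_in_ideal Dcb pcb h); last by apply: (ideal_pos pb hy); apply: hc.
by apply: (br_root_neq0 Db hy y0 Dc hx x0); rewrite addrC.
Qed.

(** Climb from any root of I by pos_root_raise; the height is bounded by the one
    of theta. *)
Lemma ideal_theta theta : highest_root br Pi theta -> I != 0%VS -> J theta.
Proof.
move=> [th_pos th_max] I0; have [c Jc] : exists c, J c.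
  have x0 : vpick I != 0 by rewrite vpick0.
  have xI : vpick I \in I by apply: memv_pick.
  have [a pa] : exists a, wproj a (vpick I) != 0.
    apply: contrapT => h; case/eqP: x0; rewrite [LHS]wproj_sum big1 // => a _.
    by apply/eqP/negPn/negP => ha; apply: h; exists a.
  by have [c _ Jc] := ideal_support xI pa; exists c.
have pos_J b : J b -> pos_root D b by case.
have [m hm] := pos_root_height ip_inner rsD th_pos.
have [l hl] := pos_root_height ip_inner rsD (pos_J _ Jc).
have [k] := ubnP (m - l); elim: k c l Jc hl => // k IH c l Jc hl mlk.
have [<-//|ne] := pselect (c = theta).
have [b pb pcb] := pos_root_raise ip_inner rsD th_pos th_max (pos_J _ Jc) ne.
have [l' hl'] := pos_root_height ip_inner rsD pcb.
apply: (IH (c + b) l') => //; first exact: ideal_up.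
have : height c < height (c + b) by rewrite heightD ltrDl (height_gt0 ip_inner
  rsD).
have : height (c + b) <= height theta.
  by apply: ler_sum => i _; apply: (theta_ge th_max).
rewrite hl hl' hm ler_nat ltr_nat; lia.
Qed.

(** The elements of I without component of weight c.  This is an ideal, since a
    bracket can only have such a component if c lies above a root of I. *)
Lemma ideal_remove c : (forall b, J b -> ~ Delta_pos br Pi (c - b)) ->
  exists I', [/\ abelian_ideal br Pi I', (I' <= I)%VS
    & forall b, ideal_roots br Pi I' b <-> J b /\ b <> c].
Proof.
move=> low; have lp : linear (wproj (wt c)).
  by move=> k x y; rewrite wprojD wprojZ.
have [p hp] := linear_hom lp; exists (I :&: lker p)%VS.
have inI x : reflect (x \in I /\ wproj (wt c) x = 0) (x \in I :&: lker p)%VS.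
  rewrite memv_cap memv_ker hp; apply: (iffP andP) => -[xI /eqP px];
    by split=> //; apply/eqP.
split; last 2 first.
- exact: capvSl.
- move=> b; split=> [[pb hb]|[[pb hb] bc]].
    split; first by split=> // x /hb/inI[].
    move=> bE; case: (pb) => Db _; have [x x0 hx] := root_vector Db.
    have /inI[_] := hb x hx; rewrite -bE (wproj_id hx) => /eqP.
    by rewrite (negbTE x0).
  split=> // x hx; apply/inI; split; first exact: hb.
  by rewrite (wproj_other hx) //; apply/eqP => /weight_of_inj /esym.
have [Iu Ib Iab] := I_ideal; split.
- by move=> x /inI[/Iu].
- move=> x y bx /inI[yI py]; apply/inI; split; first exact: Ib.
  have [h [z [ht [s hs ->] ->]]] := bx.
  rewrite (wproj_sum y) br_sumr wproj_big big1 // => a _.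
  have [->|pa] := eqVneq (wproj a y) 0; first by rewrite br0r wproj0.
  have ya := wproj_root_space a y;
    have ac : wt c != a by apply: contraNneq pa => <-; apply/eqP.
  have [b ab Jb] := ideal_support yI pa.
  rewrite brDl wprojD (wproj_other (root_space_br (t_zero_weight ht) ya))
    ?add0r //.
  rewrite br_suml wproj_big big_seq big1 // => z' /hs[d pd hd].
  apply: (wproj_other (root_space_br hd ya)); rewrite ab -weight_ofD.
  apply/eqP => /weight_of_inj cE; apply: (low b Jb); rewrite cE addrK.
  exact: pd.
- by move=> x y /inI[xI _] /inI[yI _]; apply: Iab.
Qed.

End Ideal.

Lemma ideal_le (I I' : {vspace g}) : abelian_ideal br Pi I ->
  (forall c, ideal_roots br Pi I c -> ideal_roots br Pi I' c) -> (I <= I')%VS.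
Proof.
move=> aI sub; apply/subvP => x xI; rewrite (wproj_sum x);
  apply: memv_suml => a _.
have [->|pa] := eqVneq (wproj a x) 0; first exact: mem0v.
have [c ac /sub[_]] := ideal_support aI xI pa; apply.
by rewrite -ac; apply: wproj_root_space.
Qed.

(** * Affine roots as vectors of V + R delta + R lambda *)

Variables (theta : V) (theta_highest : highest_root br Pi theta).
Let th_pos : pos_root D theta := proj1 theta_highest.
Let th_max : forall a, pos_root D a -> root_le a theta := proj2 theta_highest.
Local Notation vhat := (Vhat R n).
Local Notation act := (affine_act ip).
Local Notation coroots := (colattice ip D).
Local Notation minuscule_for w J := (forall p, affpos D p ->
  affpos D (- (w p)) <-> p.2 = 1 /\ J (- p.1)).

Definition emb (p : V * R) : vhat := (p.1, (p.2, 0)).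

Lemma vhat_eq (x y : vhat) : x.1 = y.1 -> x.2.1 = y.2.1 -> x.2.2 = y.2.2 ->
  x = y.
Proof. by case: x y => [x [k l]] [x' [k' l']] /= -> -> ->. Qed.

Lemma emb_inj : injective emb.
Proof. by move=> [x k] [y l] [-> ->]. Qed.

Lemma embD p q : emb (p + q) = emb p + emb q.
Proof. by apply: vhat_eq => //=; rewrite addr0. Qed.

Lemma embN p : emb (- p) = - emb p.
Proof. by apply: vhat_eq => //=; rewrite oppr0. Qed.

Lemma embZ (k : R) p : emb (k *: p.1, k * p.2) = k *: emb p.
Proof. by apply: vhat_eq => //=; rewrite scaler0. Qed.

Lemma delta_emb c (k : R) : inV c + k *: delta R n = emb (c, k).
Proof.
apply: vhat_eq => /=; rewrite ?scaler0 ?addr0 ?add0r //.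
exact: mulr1.
Qed.

Lemma delta_sub c : delta R n - inV c = emb (- c, 1).
Proof. by apply: vhat_eq => /=; rewrite ?add0r ?subr0 ?oppr0. Qed.

Lemma form_emb p q : Defs.form ip (emb p) (emb q) = ip p.1 q.1.
Proof. by rewrite /Defs.form /= mulr0 mul0r !addr0. Qed.

Lemma coroot_emb p : coroot ip (emb p) = emb (dual_root p.1,
  2 / ip p.1 p.1 * p.2).
Proof. by rewrite /coroot form_emb dual_root_unfold -embZ. Qed.

Lemma alpha_emb i : alpha theta i = emb (affine_simple theta i).
Proof. by case: i => //=; apply: delta_sub. Qed.

Lemma refl_emb i p : refl ip theta i (emb p) =
  emb (affine_reflection ip theta i p).
Proof.
rewrite /refl alpha_emb form_emb coroot_emb -embZ -embN -embD; congr emb.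
case: i p => [j|] [x k] /=; congr pair; rewrite /= ?mulr0 ?subr0 //.
- by rewrite /reflection (ip_dual_root ip_inner) dual_root_unfold !scalerA
  mulrC.
- rewrite /reflection (ip_dual_root ip_inner) (dual_rootN ip_inner)
  dual_root_unfold (ipNr ip_inner).
  by rewrite scaleNr scalerN opprK !scalerA mulrC.
- rewrite (ip_dual_root ip_inner) (ipNr ip_inner) (ipNl ip_inner) (ipNr
  ip_inner) opprK.
  by rewrite mulr1 mulNr opprK mulrC.
Qed.

Lemma word_emb s p : word ip theta s (emb p) = emb (affine_word ip theta s p).
Proof. by elim: s => //= i s ->; rewrite refl_emb. Qed.

Lemma word_finite vs p :
  word ip theta (map Some vs) (emb p) = emb (rword ip vs p.1, p.2).
Proof.
rewrite word_emb; congr emb; case: p => x k /=.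
by elim: vs => //= i s ->.
Qed.

Lemma affine_posE p : affine_pos br Pi (emb p) <-> affpos D p.
Proof.
split=> [[[c pc]|[c [k [Dc k0]]]]|].
- by rewrite -[inV c]/(emb (c, 0)) => /emb_inj ->; apply: affpos_finite pc.
- rewrite delta_emb => /emb_inj ->; exact: (affpos_level Dc k0).
case: p => x k [/= Dx /intrP[m kE] hk].
have [k0|[k0 px]] := hk; last by left; exists x => //; rewrite k0.
right; exists x, `|m|%N; split=> //; rewrite kE ltr0z in k0.
  by rewrite absz_gt0 gt_eqF.
by rewrite delta_emb kE natr_absz gtr0_norm.
Qed.

Lemma affine_pos_emb v : affine_pos br Pi v -> exists p, v = emb p.
Proof.
case=> [[c _ ->]|[c [k [_ _ ->]]]]; first by exists (c, 0).
by exists (c, k%:R); rewrite delta_emb.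
Qed.

(** * Minimal ideals of a given rootlet *)

Lemma minuscule_act (I : {vspace g}) w vs r :
  (forall p, w (emb p) = emb (act vs r p)) -> minuscule_of br Pi ip theta I w ->
  minuscule_for (act vs r) (ideal_roots br Pi I).
Proof.
move=> wE [_ invE] p ap; split.
- move=> h; have : inversions br Pi w (emb p).
    by split; [apply/affine_posE|rewrite wE -embN; apply/affine_posE].
  rewrite invE => -[c Jc]; rewrite delta_sub => /emb_inj <- /=.
  by rewrite opprK.
- case: p ap => x k ap /= [k1 Jx].
  have : inversions br Pi w (emb (x, k)).
    by rewrite invE k1; exists (- x) => //; rewrite delta_sub opprK.
  by case=> _; rewrite wE -embN => /affine_posE.
Qed.

Lemma minuscule_word (I : {vspace g}) s vs r :
  affine_word ip theta s =1 act vs r ->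
  minuscule_for (act vs r) (ideal_roots br Pi I) ->
  minuscule_of br Pi ip theta I (word ip theta s).
Proof.
move=> sE wJ; split; first by exists s.
apply/seteqP; split=> [v [pv nv]|v [c Jc <-]].
  have [p vE] := affine_pos_emb pv; move: pv nv; rewrite vE.
  move/affine_posE => ap; rewrite word_emb -embN => /affine_posE.
  rewrite sE => /(wJ p ap)[p2 Jp]; exists (- p.1) => //.
  by rewrite delta_sub opprK -p2; case: (p).
have ap : affpos D (- c, 1).
  by case: Jc => -[Dc _] _; apply: (affpos_level (k := 1)) => //;
    apply: rs_opp ip_inner _ rsD _ Dc.
rewrite delta_sub; split; first exact/affine_posE.
rewrite word_emb -embN; apply/affine_posE; rewrite sE; apply/wJ => //.
by rewrite /= opprK.
Qed.

(** 2 delta - theta is the pair (- theta, 2). *)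
Lemma rootlet_emb w vs r : (forall p, w (emb p) = emb (act vs r p)) ->
  rootlet theta w = emb (act vs r (- theta, 2)).
Proof.
move=> wE; rewrite -wE /rootlet mulr2n; congr w.
by apply: vhat_eq => /=; rewrite ?subr0 ?addr0 // sub0r.
Qed.

Lemma weyl_decomp s : exists vs r, [/\ coroots r,
  affine_word ip theta s =1 act vs r
  & forall p, word ip theta s (emb p) = emb (act vs r p)].
Proof.
have [vs [r [cr sE]]] := affine_word_decomp ip_inner rsD th_pos s.
by exists vs, r; split=> // p; rewrite word_emb sE.
Qed.

Lemma kostant_peterson_act w z : kostant_peterson ip theta w z ->
  exists vs r, [/\ coroots r, forall p, w (emb p) = emb (act vs r p)
    & z = emb (rword ip vs r, 0)].
Proof.
move=> [v [r [[[vs ->] [m rE] wE] ->]]].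
pose r0 : V := \sum_i (m i)%:~R *: dual_root (delta_mx 0 i).
have {}rE : r = emb (r0, 0).
  rewrite rE (_ : (r0, 0) = \sum_i ((m i)%:~R *: dual_root (delta_mx 0 i), 0)).
    elim/big_rec2: _ => [|i x y _ ->]; first by [].
    by rewrite embD alpha_emb coroot_emb -embZ /= !mulr0.
  apply: (big_rec2 (fun (x : V) (y : V * R) => (x, 0) = y)) => // i y x _ <-.
  by congr pair; rewrite /= addr0.
exists vs, r0; split; last by rewrite rE word_finite.
  apply: colattice_sum => i; apply: (colatticeZ ip_inner rsD).
  by apply: colattice_dual_root; apply: (rs_simple rsD).
move=> p; rewrite wE // /translation rE form_emb (_ : _ - _ = emb (p.1,
  p.2 - ip p.1 r0)).
  by rewrite word_finite.
apply: vhat_eq => /=; rewrite ?scaler0 ?subr0 //.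
by congr (_ - _); apply: mulr1.
Qed.

Section Minuscule.
Variables (I : {vspace g}) (w : vhat -> vhat) (vs : seq 'I_n) (r : V).
Hypotheses (I_ideal : abelian_ideal br Pi I) (I_neq0 : I != 0%VS).
Hypotheses (w_I : minuscule_of br Pi ip theta I w) (cr : coroots r).
Hypothesis (wE : forall p, w (emb p) = emb (act vs r p)).
Local Notation J := (ideal_roots br Pi I).

Let wJ := minuscule_act wE w_I.
Let J_theta : J theta := ideal_theta I_ideal theta_highest I_neq0.

Lemma rootlet_finite : rootlet theta w = emb (- rword ip vs theta, 0).
Proof.
rewrite (rootlet_emb wE) /affine_act /= (rwordN ip_inner) (ipNl ip_inner).
rewrite (minuscule_theta ip_inner rsD th_pos th_max cr wJ J_theta);
  congr (emb (_, _)).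
by rewrite opprK subrr.
Qed.

Lemma coroot_rootlet : coroot ip (rootlet theta w) = emb (rword ip vs r, 0) <->
  r = - dual_root theta.
Proof.
rewrite rootlet_finite coroot_emb mulr0 /= (dual_rootN ip_inner).
rewrite -(rword_dual_root ip_inner rsD) -(rwordN ip_inner); split=> [|->] //.
by move=> /emb_inj[/(rword_inj ip_inner rsD)].
Qed.

Lemma level_iff_translation : (forall c, J c ->
  0 < ip c theta) <-> r = - dual_root theta.
Proof.
split=> [JH|rE c Jc].
  by apply: (minuscule_translation ip_inner rsD th_pos th_max cr wJ J_theta) =>
    a _; apply: JH.
by apply: (minuscule_level ip_inner rsD th_pos wJ rE _ Jc); case: Jc.
Qed.

Lemma affine_reflection_orthogonal i p :
  ip p.1 (affine_simple theta i).1 = 0 -> affine_reflection ip theta i p = p.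
Proof.
case: i p => [j|] [x k] /= h; rewrite /reflection (ip_dual_root ip_inner).
  by rewrite h mulr0 scale0r subr0.
have -> : ip x theta = 0 by rewrite -[theta]opprK (ipNr ip_inner) h oppr0.
by rewrite mulr0 scale0r subr0 addr0.
Qed.

(** Since c is orthogonal to theta, the simple affine root - w(delta - c) is
    orthogonal to the rootlet w(2 delta - theta), which therefore does not
    change on passing to s_i w. *)
Lemma minuscule_remove c : J c -> ip c theta = 0 ->
  (forall b, J b -> ~ pos_root D (c - b)) ->
  exists I', [/\ (I' <= I)%VS,
    I' <> I & Ab br Pi ip theta (rootlet theta w) I'].
Proof.
move=> Jc cth low; have pc : pos_root D c by case: Jc.
have [i wi] := minuscule_lowest ip_inner rsD th_pos th_max cr wJ pc Jc low.
have [I' [aI' leI' JI']] := ideal_remove I_ideal low.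
have JI'th : ideal_roots br Pi I' theta.
  apply/JI'; split=> // thc.
  have := ip_gt0 ip_inner (theta_neq0 rsD th_pos).
  by rewrite {1}thc cth ltxx.
exists I'; split=> //.
  by move=> II'; have := Jc; rewrite -II' => /JI'[].
split=> //.
  apply/eqP => I'0; case: JI'th => -[Dth _] hth.
  have [x x0 hx] := root_vector Dth; have := hth x hx.
  by rewrite I'0 memv0 (negbTE x0).
case: w_I => -[s ws] _; have sE p : affine_word ip theta s p = act vs r p.
  by apply: emb_inj; rewrite -word_emb -ws wE.
have [vs' [r' [cr' sE' wE']]] := weyl_decomp (i :: s).
exists (word ip theta (i :: s)).
  apply: (minuscule_word sE') => p ap; rewrite -sE' /= sE.
  have [mr mr'] := minuscule_reflect ip_inner rsD th_pos th_max wJ pc wi ap.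
  by split=> [/mr[-> ] /JI'|[p2 /JI' h]]; [split|apply: mr'; split].
rewrite (rootlet_emb wE') -sE' /= sE (rootlet_emb wE); congr emb.
apply: affine_reflection_orthogonal; rewrite -wi /= (rword_ip ip_inner rsD).
by rewrite (ipNl ip_inner) (ipC ip_inner) cth oppr0.
Qed.

(** A root of I of smallest height among those orthogonal to theta is minimal in
    I, because roots below it are orthogonal to theta as well. *)
Lemma minimal_level : Ab_minimal br Pi ip theta (rootlet theta w) I ->
  forall c, J c -> 0 < ip c theta.
Proof.
move=> [_ Imin] c Jc; have pc : pos_root D c by case: Jc.
move: c pc Jc; apply: (pos_root_ind ip_inner rsD) => c pc IH Jc.
rewrite ltNge; apply/negP => c0.
have th0 b : pos_root D b -> 0 <= ip b theta by move=> pb;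
  apply: (theta_dominant ip_inner rsD th_pos th_max pb).
have [|b Jb pcb|I' [leI' neI' AbI']] := minuscule_remove Jc.
- by apply/eqP; rewrite eq_le c0 th0.
- have pb : pos_root D b by case: Jb.
  have := IH b pb; rewrite -(subrK b c) heightD ltrDr (height_gt0 ip_inner rsD
    pcb).
  move=> /(_ isT Jb); have := th0 _ pcb; rewrite (ipBl ip_inner); lra.
- by apply: neI'; apply: Imin.
Qed.

End Minuscule.

Lemma ideal_roots_mono (I I' : {vspace g}) c : (I <= I')%VS ->
  ideal_roots br Pi I c -> ideal_roots br Pi I' c.
Proof. by move=> /subvP sII' [pc hc]; split=> // x /hc/sII'. Qed.

Lemma ideal_of_rootlet (I1 I2 : {vspace g}) w1 w2 :
  abelian_ideal br Pi I1 -> abelian_ideal br Pi I2 -> I1 != 0%VS ->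
    I2 != 0%VS ->
  minuscule_of br Pi ip theta I1 w1 -> minuscule_of br Pi ip theta I2 w2 ->
  (forall c, ideal_roots br Pi I1 c -> 0 < ip c theta) ->
  (forall c, ideal_roots br Pi I2 c -> 0 < ip c theta) ->
  rootlet theta w1 = rootlet theta w2 -> I1 = I2.
Proof.
move=> a1 a2 I10 I20 m1 m2 H1 H2.
have act_of w : affine_weyl ip theta w -> exists vs r, coroots r /\
    forall p, w (emb p) = emb (act vs r p).
  by move=> [s ->]; have [vs [r [cr _ wE]]] := weyl_decomp s; exists vs, r.
have [vs1 [r1 [cr1 wE1]]] := act_of _ (proj1 m1).
have [vs2 [r2 [cr2 wE2]]] := act_of _ (proj1 m2).
rewrite (rootlet_finite a1 I10 m1 cr1 wE1) (rootlet_finite a2 I20 m2 cr2 wE2).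
move=> /emb_inj[/oppr_inj thE].
have r1E := (level_iff_translation a1 I10 m1 cr1 wE1).1 H1.
have r2E := (level_iff_translation a2 I20 m2 cr2 wE2).1 H2.
have J1 := minuscule_act wE1 m1; have J2 := minuscule_act wE2 m2.
rewrite r1E in J1; rewrite r2E in J2.
have J12 := minuscule_unique ip_inner rsD th_pos th_max J1 J2 thE.
apply/eqP; rewrite eqEsubv; apply/andP; split; apply: ideal_le => // c Jc.
  by apply/J12 => //; case: Jc.
by apply/J12 => //; case: Jc.
Qed.

Lemma minimal_iff_coroot (I : {vspace g}) w z :
  abelian_ideal br Pi I -> I != 0%VS -> minuscule_of br Pi ip theta I w ->
  kostant_peterson ip theta w z ->
  is_Imin br Pi ip theta (rootlet theta w) I <-> coroot ip (rootlet theta w) =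
    z.
Proof.
move=> aI I0 mI /kostant_peterson_act[vs [r [cr wE ->]]].
rewrite (coroot_rootlet aI I0 mI cr wE) -(level_iff_translation aI I0 mI cr wE).
split=> [[Imin _]|IH]; first exact: (minimal_level aI I0 mI cr wE Imin).
have min_eq b : Ab br Pi ip theta (rootlet theta w) b ->
    (forall c, ideal_roots br Pi b c -> 0 < ip c theta) -> b = I.
  by move=> [ab b0 [wb mb rb]] bH; apply: (ideal_of_rootlet ab aI b0 I0 mb mI).
have AbI : Ab br Pi ip theta (rootlet theta w) I by split=> //; exists w.
split; first split=> // b Abb bI.
  by apply: min_eq Abb _ => c /(ideal_roots_mono bI)/IH.
move=> b [Abb bmin]; apply: min_eq => // c.
have [ab b0 [wb mb rb]] := Abb; have [s ws] := proj1 mb.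
have [vb [rb' [crb _ wbE]]] := weyl_decomp s; rewrite -ws in wbE.
by apply: (minimal_level ab b0 mb crb wbE); rewrite rb.
Qed.

End Basis.
End Lie.

Theorem theorem0p2 (R : realType) (g : vectType R[i]) (br : g -> g -> g)
    (g_lie : lie_bracket br) (g_simple : simple_lie br)
    (t : {vspace g}) (t_cartan : cartan_subalgebra br t)
    (n : nat) (Pi : n.-tuple (dual t)) (Pi_simple : simple_roots br Pi)
    (ip : 'rV[R]_n -> 'rV[R]_n -> R)
    (ip_inner : inner_product ip) (ip_weyl : weyl_invariant br Pi ip)
    (theta : 'rV[R]_n) (theta_highest : highest_root br Pi theta)
    (I : {vspace g}) (I_ideal : abelian_ideal br Pi I) (I_neq0 : I != 0%VS)
    (w : Vhat R n -> Vhat R n) (w_I : minuscule_of br Pi ip theta I w)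
    (z : Vhat R n) (z_I : kostant_peterson ip theta w z) :
  is_Imin br Pi ip theta (rootlet theta w) I <->
  coroot ip (rootlet theta w) = z.
Proof.
have [N [X [xi [X_basis X_wt]]]] := eigenbasis g_lie t_cartan.
exact: (minimal_iff_coroot g_lie t_cartan X_basis X_wt).
Qed.
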